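(* Let $K>1$. For each integer $s\ge1$ let $\alpha_s(K)=\frac{2Ks+1}{2K(s-1)+1}$, and let $S_K$ be the weighted forward shift on $\ell^2_+=\ell^2(\mathbb{N},\mathbb{C})$ given by $S_K(z_0,z_1,\dots)=(0,\alpha_1(K)z_0,\alpha_2(K)z_1,\dots)$. (1) If $T\in\mathcal{B}(\mathcal{H})$ ($\mathcal{H}$ a Hilbert space) satisfies $\|T^n\|\le K$ for every $n\ge0$, then $\|p(T)\|\le\|p(S_K)\|$ for every polynomial $p$ with complex coefficients. (2) For any fixed $K>1$, there is no power bounded weighted forward shift $E$ such that $\|f(A)\|\le\|f(E)\|$ holds for every power bounded operator $A$ on a Hilbert space with $\sup_{n\ge0}\|A^n\|\le K$ and every polynomial $f$.
   Context: An operator $A$ is power bounded if $\sup_{n\ge0}\|A^n\|<\infty$. A weighted forward shift is an operator of the form $(z_0,z_1,\dots)\mapsto(0,w_1z_0,w_2z_1,\dots)$ on $\ell^2_+$ for a bounded weight sequence $(w_s)$. *)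

(* Defs.v *)
From HB Require Import structures.
From mathcomp Require Import all_boot all_order all_algebra.
From mathcomp Require Import all_classical all_reals.
From mathcomp Require Import ereal sequences.
From mathcomp.real_closed Require Import complex.

Set Implicit Arguments.
Unset Strict Implicit.
Unset Printing Implicit Defensive.

Import Order.TTheory GRing.Theory Num.Theory.
Local Open Scope ring_scope.

Record hilbertSpace (R : realType) := HilbertSpace {
  hvec :> lmodType R[i];
  hinner : hvec -> hvec -> R[i];
  hinner_linear : forall (a : R[i]) (x y z : hvec),
      hinner (a *: x + y) z = a * hinner x z + hinner y z;
  hinner_conj : forall x y : hvec, hinner y x = conjc (hinner x y);
  hinner_ge0 : forall x : hvec, 0 <= hinner x x;
  hinner_eq0 : forall x : hvec, hinner x x = 0 -> x = 0;
  hcomplete : forall u : nat -> hvec,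
      (forall e : R, 0 < e -> exists N : nat, forall m n : nat, (N <= m)%N -> (N <= n)%N ->
          Num.sqrt (complex.Re (hinner (u m - u n) (u m - u n))) < e) ->
      exists l : hvec, forall e : R, 0 < e -> exists N : nat, forall n : nat, (N <= n)%N ->
          Num.sqrt (complex.Re (hinner (u n - l) (u n - l))) < e
}.

Section Hilbert.
Variables (R : realType) (H : hilbertSpace R).

Definition hnorm (x : H) : R := Num.sqrt (complex.Re (hinner x x)).

Definition bounded_linear (T : H -> H) : Prop :=
  (forall (a : R[i]) (x y : H), T (a *: x + y) = a *: T x + T y) /\
  exists M : R, forall x : H, hnorm (T x) <= M * hnorm x.

Definition opnorm (T : H -> H) : \bar R :=
  ereal_sup [set (hnorm (T x))%:E | x in [set x : H | hnorm x <= 1]].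

Definition polyop (p : {poly R[i]}) (T : H -> H) (x : H) : H :=
  \sum_(i < size p) p`_i *: iter i T x.

End Hilbert.

Section L2.
Variable R : realType.

Definition cabs (z : R[i]) : R :=
  Num.sqrt (complex.Re z ^+ 2 + complex.Im z ^+ 2).

(* squared l^2 norm, as an extended real (+oo if z is not in l^2) *)
Definition l2sq (z : nat -> R[i]) : \bar R :=
  (\sum_(k <oo) ((cabs (z k)) ^+ 2)%:E)%E.

Definition l2norm (z : nat -> R[i]) : \bar R :=
  match l2sq z with
  | EFin r => (Num.sqrt r)%:E
  | x => x
  end.

Definition opnorm_l2 (A : (nat -> R[i]) -> (nat -> R[i])) : \bar R :=
  ereal_sup [set l2norm (A z) | z in [set z | (l2norm z <= 1%:E)%E]].

Definition polyop_seq (p : {poly R[i]}) (A : (nat -> R[i]) -> (nat -> R[i]))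
    (z : nat -> R[i]) : nat -> R[i] :=
  fun n => \sum_(i < size p) p`_i * iter i A z n.

Definition wshift (w : nat -> R[i]) (z : nat -> R[i]) : nat -> R[i] :=
  fun n => match n with 0 => 0 | m.+1 => w m.+1 * z m end.

Definition bounded_weight (w : nat -> R[i]) : Prop :=
  exists M : R, forall s : nat, (0 < s)%N -> cabs (w s) <= M.

Definition power_bounded_l2 (A : (nat -> R[i]) -> (nat -> R[i])) : Prop :=
  exists M : R, forall n : nat, (opnorm_l2 (iter n A) <= M%:E)%E.

Definition alphaK (K : R) (s : nat) : R :=
  (2 * K * s%:R + 1) / (2 * K * (s%:R - 1) + 1).

Definition S_K (K : R) : (nat -> R[i]) -> (nat -> R[i]) :=
  wshift (fun s => real_complex R (alphaK K s)).

End L2.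

(* Main.v *)
(* (1) The weights of S_K have products beta_n = 2Kn+1.  The sequence
   a_n = 1/beta_n^2 is log-convex, so by Kaluza's lemma its convolution inverse
   e satisfies e_0 = 1 and -a_k <= e_k <= 0.  As K^2 (a_1 + a_2 + ...) <= 1, the
   form q(x,y) = sum_k e_k <T^k x, T^k y> is nonnegative, and
   sum_n a_n q(T^n x, T^n x) = |x|^2.  Hence x |-> (T^n x / beta_n)_n maps H
   isometrically (for q) into a multiple of l^2 and intertwines T with the
   adjoint of S_K.  All sums are truncated, with an error O(1/L), so neither q
   nor the intertwining is completed to an operator.

   (2) A power bounded weighted shift is a contraction for an equivalent
   weighted l^2 norm, so polynomials built by a Rudin-Shapiro type recursion,
   which only uses the parallelogram law, have uniformly bounded norm on it,
   while their coefficients at the frequencies 2^k have a divergent sum.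
   On a truncated Foguel-Hankel operator with lacunary symbol, whose
   off-diagonal block is small enough for the power bound K, this sum is read
   off a single matrix entry. *)
Require Import Defs.
From HB Require Import structures.
From mathcomp Require Import all_boot all_order all_algebra.
From mathcomp Require Import all_classical all_reals.
From mathcomp Require Import ereal sequences.
From mathcomp.real_closed Require Import complex.
From mathcomp Require Import ring lra zify.
Import Order.TTheory GRing.Theory Num.Theory.
Local Open Scope ring_scope.

Set Implicit Arguments.
Unset Strict Implicit.
Unset Printing Implicit Defensive.

(** * Kaluza's lemma and domination of Gram sums *)

(** The inverse is built one coefficient at a time, each forced by the vanishing of the next
    convolution; log-convexity controls its sign. Stopping at order [N] suffices because all later
    sums are truncated. *)
Lemma kaluza (R : realFieldType) (a : nat -> R) (N : nat) :
    a 0 = 1 -> (forall n, 0 < a n) ->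
    (forall m n, (m <= n)%N -> a m.+1 * a n <= a m * a n.+1) ->
  exists e : nat -> R, [/\ e 0 = 1, forall k, (0 < k)%N -> - a k <= e k <= 0
    & forall m, (0 < m <= N)%N -> \sum_(k < m.+1) e k * a (m - k)%N = 0].
Proof.
move=> a0 a_gt0 a_cvx; elim: N => [|N [e [e0 e_bnd e_conv]]].
  exists (fun k => (k == 0)%:R); split=> [//|k|m]; last by case: m.
  by case: k => // k _; rewrite oppr_le0 ltW // lexx.
pose s := \sum_(k < N.+1) e k * a (N.+1 - k)%N.
have s_le : s <= a N.+1.
  rewrite /s big_ord_recl /= e0 mul1r subn0 gerDl sumr_le0 // => i _.
  by apply: mulr_le0_ge0; [case/andP: (e_bnd (bump 0 i) isT)|exact/ltW/a_gt0].
have s_ge0 : 0 <= s.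
  case: (posnP N) => [N0|N_gt0].
    by rewrite /s N0 big_ord1 e0 mul1r ltW.
  have e_convN := e_conv N; rewrite N_gt0 leqnn in e_convN.
  rewrite -(pmulr_rge0 _ (a_gt0 N)).
  (* From a_N s subtract a_{N+1} times the convolution of order N, which is zero. The terms of index
     0 cancel, and each remaining one is e_i <= 0 times a factor that log-convexity makes
     nonpositive. *)
  rewrite -[X in _ <= X]subr0 -[X in _ - X](mulr0 (a N.+1)) -[X in _ - _ * X](e_convN isT).
  rewrite !mulr_sumr -sumrB big_ord_recl /= subn0 subn0 e0 !mul1r mulrC subrr add0r.
  apply: sumr_ge0 => i _.
  case/andP: (e_bnd (bump 0 i) isT) => _ ei_le0.
  have iN : (bump 0 i <= N)%N by [].
  rewrite subSn // mulrCA [X in _ - X]mulrCA -mulrBr mulr_le0 //.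
  rewrite subr_le0 [X in X <= _]mulrC [X in _ <= X]mulrC.
  exact/a_cvx/leq_subr.
exists (fun k => if k == N.+1 then - s else e k); split=> //.
- by move=> k k_gt0; case: eqP => [->|_]; [rewrite lerN2 s_le oppr_le0|exact: e_bnd].
- move=> m /andP[m_gt0]; rewrite leq_eqVlt => /orP[/eqP->|]; last first.
    rewrite ltnS => mN; rewrite -[RHS](e_conv m) ?m_gt0 //.
    by apply: eq_bigr => i _; rewrite ltn_eqF // (leq_trans (ltn_ord i)).
  rewrite big_ord_recr /= eqxx subnn a0 mulr1 -/s; apply/eqP.
  rewrite subr_eq0; apply/eqP/eq_bigr => i _.
  by rewrite ltn_eqF.
Qed.

Section Domination.
Variable C : numClosedFieldType.
Local Open Scope sesquilinear_scope.

(** Diagonalising G = P^* D P with D >= 0 splits both sides into sums over the eigenvalues. For the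
    l-th one the inequality is the hypothesis on [B] at the conjugate of row l of P. *)
Lemma gram_dominated n m (G : 'M[C]_n) (B : 'M[C]_(n, m)) (t : C) :
    (forall i j, G j i = (G i j)^*) ->
    (forall z : 'rV_n, 0 <= (z *m G *m z^t*) 0 0) ->
    (forall z : 'rV_n, \sum_j `|(z *m B) 0 j| ^+ 2 <= t * \sum_i `|z 0 i| ^+ 2) ->
  \sum_j \sum_i \sum_k B i j * (B k j)^* * G i k <= t * \sum_i G i i.
Proof.
move=> G_herm G_ge0 B_le.
have Gh : G \is hermsymmx.
  apply/is_hermitianmxP; rewrite expr0 scale1r; apply/matrixP=> i j.
  by rewrite !mxE -G_herm.
have /orthomx_spectralP G_eq := hermitian_normalmx Gh.
set P := spectralmx G in G_eq; set D := spectral_diag G in G_eq.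
have P_un : P \is unitarymx by apply: spectral_unitarymx.
have P_unit : P \in unitmx by apply: spectral_unit.
rewrite (invmx_unitary P_un) in G_eq.
have GE i k : G i k = \sum_l (P l i)^* * D 0 l * P l k.
  rewrite {1}G_eq mxE; apply: eq_bigr => l _.
  by rewrite mul_mx_diag !mxE.
have D_ge0 l : 0 <= D 0 l.
  suff -> : D 0 l = (row l P *m G *m (row l P)^t*) 0 0 by [].
  have PPt := unitarymxP P_un.
  have <- : (P *m G *m P^t*) l l = (row l P *m G *m (row l P)^t*) 0 0.
    rewrite !mxE; apply: eq_bigr => j _; rewrite !mxE; congr (_ * _).
    by apply: eq_bigr => k _; rewrite !mxE.
  by rewrite {1}G_eq !mulmxA PPt mul1mx -mulmxA PPt mulmx1 mxE eqxx.
have B_leP l : \sum_j `|\sum_i (P l i)^* * B i j| ^+ 2 <= t * \sum_i `|P l i| ^+ 2.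
  have := B_le (\row_i (P l i)^*).
  under eq_bigr do rewrite mxE; under [X in _ <= _ * X]eq_bigr do rewrite mxE norm_conjC.
  by congr (_ <= _); apply: eq_bigr => j _; congr (`|_| ^+ 2); apply: eq_bigr => i _;
    rewrite mxE.
have -> : \sum_j \sum_i \sum_k B i j * (B k j)^* * G i k =
    \sum_l D 0 l * \sum_j `|\sum_i (P l i)^* * B i j| ^+ 2.
  under [RHS]eq_bigr do rewrite mulr_sumr; rewrite [RHS]exchange_big /=.
  apply: eq_bigr => j _.
  transitivity (\sum_i \sum_k \sum_l B i j * (B k j)^* * ((P l i)^* * D 0 l * P l k)).
    by apply: eq_bigr => i _; apply: eq_bigr => k _; rewrite GE mulr_sumr.
  transitivity (\sum_i \sum_l \sum_k B i j * (B k j)^* * ((P l i)^* * D 0 l * P l k)).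
    by apply: eq_bigr => i _; rewrite exchange_big.
  rewrite exchange_big /=.
  apply: eq_bigr => l _; rewrite normCK rmorph_sum mulr_suml mulr_sumr.
  apply: eq_bigr => i _; rewrite mulr_sumr mulr_sumr.
  by apply: eq_bigr => k _; rewrite rmorphM /= conjCK; ring.
have -> : \sum_i G i i = \sum_l D 0 l * \sum_i `|P l i| ^+ 2.
  under [RHS]eq_bigr do rewrite mulr_sumr; rewrite [RHS]exchange_big /=.
  apply: eq_bigr => i _; rewrite GE; apply: eq_bigr => l _.
  by rewrite normCK; ring.
rewrite mulr_sumr; apply: ler_sum => l _.
by rewrite mulrCA ler_wpM2l.
Qed.

End Domination.

Lemma sum_ord_vanish (V : nmodType) (f : nat -> V) (m n : nat) :
    (forall i, (m <= i)%N -> f i = 0) -> (forall i, (n <= i)%N -> f i = 0) ->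
  \sum_(i < m) f i = \sum_(i < n) f i.
Proof.
wlog mn : m n / (m <= n)%N => [hw fm fn|fm _].
  by case: (leqP m n) => [|/ltnW] /hw -> //.
rewrite (big_ord_widen n _ mn) big_mkcond; apply: eq_bigr => i _.
by case: ltnP => // /fm.
Qed.

Section SemiInner.
Variables (R : realType) (V : lmodType R[i]) (q : V -> V -> R[i]).
Hypotheses (q_lin : forall a x y z, q (a *: x + y) z = a * q x z + q y z)
  (q_conj : forall x y, q y x = conjc (q x y))
  (q_ge0 : forall x, 0 <= q x x).

Lemma form0l z : q 0 z = 0.
Proof.
have := q_lin 1 0 0 z; rewrite scale1r addr0 mul1r => /eqP.
by rewrite -subr_eq0 opprD addrA subrr add0r oppr_eq0 => /eqP.
Qed.

Lemma formDl x y z : q (x + y) z = q x z + q y z.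
Proof. by rewrite -[x]scale1r q_lin scale1r mul1r. Qed.

Lemma formZl a x z : q (a *: x) z = a * q x z.
Proof. by rewrite -[a *: x]addr0 q_lin form0l addr0. Qed.

Lemma formZr a x z : q x (a *: z) = conjc a * q x z.
Proof. by rewrite q_conj formZl rmorphM /= -q_conj. Qed.

Lemma form_suml (I : Type) (r : seq I) (P : pred I) (F : I -> V) z :
  q (\sum_(i <- r | P i) F i) z = \sum_(i <- r | P i) q (F i) z.
Proof.
by apply: (big_morph (q^~ z)) => [x y|]; rewrite ?form0l ?formDl.
Qed.

Lemma form_sumr (I : Type) (r : seq I) (P : pred I) (F : I -> V) z :
  q z (\sum_(i <- r | P i) F i) = \sum_(i <- r | P i) q z (F i).
Proof.
by rewrite q_conj form_suml rmorph_sum; apply: eq_bigr => i _; rewrite [RHS]q_conj.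
Qed.

(** A scalar matrix bound passes to vectors measured by a possibly degenerate form, since only the
    Gram matrix of the [v i] matters. This replaces the tensor product of an operator with the
    identity of a completed space. *)
Lemma form_dominated n m (B : 'I_n -> 'I_m -> R[i]) (t : R[i]) (v : 'I_n -> V) :
    (forall z : 'I_n -> R[i],
      \sum_j `|\sum_i B i j * z i| ^+ 2 <= t * \sum_i `|z i| ^+ 2) ->
  \sum_j q (\sum_i B i j *: v i) (\sum_i B i j *: v i) <= t * \sum_i q (v i) (v i).
Proof.
move=> B_le.
have -> : \sum_j q (\sum_i B i j *: v i) (\sum_i B i j *: v i) =
    \sum_j \sum_i \sum_k B i j * conjc (B k j) * q (v i) (v k).
  apply: eq_bigr => j _; rewrite form_suml; apply: eq_bigr => i _.
  rewrite formZl form_sumr mulr_sumr; apply: eq_bigr => k _.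
  by rewrite formZr mulrA.
have := @gram_dominated _ _ _ (\matrix_(i, j) q (v i) (v j)) (\matrix_(i, j) B i j) t.
under eq_bigr do under eq_bigr do under eq_bigr do rewrite !mxE.
under [X in _ <= _ * X]eq_bigr do rewrite mxE.
apply.
- by move=> i j; rewrite !mxE q_conj.
- move=> z; rewrite -mulmxA mxE.
  have := q_ge0 (\sum_i z 0 i *: v i); congr (_ <= _).
  rewrite form_suml; apply: eq_bigr => i _; rewrite formZl form_sumr mxE.
  congr (_ * _); apply: eq_bigr => j _.
  by rewrite !mxE formZr mulrC.
- move=> z; have := B_le (z 0); congr (_ <= _).
  apply: eq_bigr => j _; congr (`|_| ^+ 2); rewrite mxE; apply: eq_bigr => i _.
  by rewrite mxE mulrC.
Qed.

End SemiInner.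

(** * Log-convexity and summability of the inverse squared weights of S_K *)

Section Weights.
Variables (R : realType) (K : R).
Hypothesis K_gt1 : 1 < K.

Definition betaK (n : nat) : R := 2 * K * n%:R + 1.

Lemma betaK_ge n : n.+1%:R <= betaK n.
Proof.
rewrite /betaK -natr1 lerD2r ler_peMl ?ler0n //.
by move: K_gt1; lra.
Qed.

Lemma betaK_gt0 n : 0 < betaK n.
Proof. exact: lt_le_trans (betaK_ge n). Qed.

Definition sqweight (n : nat) : R := (betaK n)^-1 ^+ 2.

Lemma sqweight_gt0 n : 0 < sqweight n.
Proof. by rewrite exprn_gt0 // invr_gt0 betaK_gt0. Qed.

Lemma sqweight_le n : sqweight n <= n.+1%:R^-1 ^+ 2.
Proof.
by rewrite lerXn2r ?nnegrE ?invr_ge0 ?ler0n ?(ltW (betaK_gt0 _)) //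
  lef_pV2 ?posrE ?betaK_gt0 ?ltr0n // betaK_ge.
Qed.

(** An arithmetic progression is log-concave, so its inverse square is log-convex. *)
Lemma sqweight_log_convex m n : (m <= n)%N ->
  sqweight m.+1 * sqweight n <= sqweight m * sqweight n.+1.
Proof.
move=> mn; rewrite /sqweight -!exprMn -!invfM.
have b0 k := betaK_gt0 k.
rewrite lerXn2r ?nnegrE ?invr_ge0 ?mulr_ge0 ?(ltW (b0 _)) //.
rewrite lef_pV2 ?posrE ?mulr_gt0 ?b0 // /betaK -!natr1.
have : (m%:R : R) <= n%:R by rewrite ler_nat.
have K0 : 0 < K := lt_trans ltr01 K_gt1.
move=> h; rewrite -subr_ge0.
rewrite (_ : _ - _ = (2 * K) ^+ 2 * (n%:R - m%:R)); last by ring.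
by rewrite mulr_ge0 ?sqr_ge0 // subr_ge0.
Qed.

(** The sharper bound 2 - 1/(N+1) telescopes, which makes the induction work. *)
Lemma sum_inv_sqr N : \sum_(k < N) (k.+1%:R^-1 : R) ^+ 2 <= 2.
Proof.
suff: \sum_(k < N.+1) (k.+1%:R^-1 : R) ^+ 2 <= 2 - N.+1%:R^-1.
  rewrite big_ord_recr /= => h; apply: le_trans (le_trans h _).
    by rewrite lerDl sqr_ge0.
  by rewrite lerBlDr lerDl invr_ge0 ler0n.
elim: N => [|N IH]; first by rewrite big_ord1 invr1; lra.
rewrite big_ord_recr /=; apply: le_trans (lerD IH (lexx _)) _.
have h : 0 < N.+1%:R :> R by rewrite ltr0n.
rewrite -(natr1 N.+1); set x : R := N.+1%:R in h *.
rewrite -subr_ge0.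
have -> : 2 - (x + 1)^-1 - (2 - x^-1 + (x + 1)^-1 ^+ 2) = (x * (x + 1) ^+ 2)^-1.
  by field; apply/andP; split; lra.
by rewrite invr_ge0 mulr_ge0 ?sqr_ge0 // ltW.
Qed.

(** As beta_k > 2Kk, comparison with the sum of 1/(2Kk)^2 even gives the bound 1/2. This is what
    makes the form q nonnegative on orbits bounded by K. *)
Lemma sum_sqweight_le N : K ^+ 2 * \sum_(k < N) sqweight k.+1 <= 1.
Proof.
have K0 : 0 < K := lt_trans ltr01 K_gt1.
suff : \sum_(k < N) sqweight k.+1 <= \sum_(k < N) (2 * K)^-1 ^+ 2 * (k.+1%:R^-1 : R) ^+ 2.
  rewrite -mulr_sumr => h.
  have h2 : K ^+ 2 * ((2 * K)^-1 ^+ 2 * \sum_(k < N) (k.+1%:R^-1 : R) ^+ 2) <= 1.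
    rewrite mulrA (_ : K ^+ 2 * (2 * K)^-1 ^+ 2 = 4^-1); last by field; lra.
    by have := sum_inv_sqr N; lra.
  by apply: le_trans h2; rewrite ler_wpM2l ?sqr_ge0.
apply: ler_sum => k _; rewrite -exprMn -invfM.
have k0 : 0 < k.+1%:R :> R by rewrite ltr0n.
rewrite lerXn2r ?nnegrE ?invr_ge0 ?mulr_ge0 ?(ltW (betaK_gt0 _)) ?(ltW k0) ?(ltW K0) //.
by rewrite lef_pV2 ?posrE ?betaK_gt0 ?mulr_gt0 // /betaK lerDl.
Qed.

(** With x = m+1 and y = n+1, write 1/(xy) = (1/x + 1/y)/(x + y) and use x + y >= L+1. Summed over
    about L^2 pairs, the right-hand side is only O(1/L). *)
Lemma sqweight_pair_le (m n L : nat) : (L <= m + n)%N ->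
  sqweight m * sqweight n <=
  2 * L.+1%:R^-1 ^+ 2 * (m.+1%:R^-1 ^+ 2 + n.+1%:R^-1 ^+ 2).
Proof.
move=> Lmn.
apply: le_trans (ler_pM (ltW (sqweight_gt0 _)) (ltW (sqweight_gt0 _)) (sqweight_le m)
  (sqweight_le n)) _.
have m0 : 0 < m.+1%:R :> R by rewrite ltr0n.
have n0 : 0 < n.+1%:R :> R by rewrite ltr0n.
have L0 : 0 < L.+1%:R :> R by rewrite ltr0n.
have : (L.+1%:R : R) <= m.+1%:R + n.+1%:R by rewrite -natrD ler_nat; lia.
move: (m.+1%:R : R) (n.+1%:R : R) (L.+1%:R : R) m0 n0 L0 => x y z x0 y0 z0 zxy.
have zi : z^-1 * z = 1 by rewrite mulVf ?gt_eqF.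
have zp : 0 < z^-1 by rewrite invr_gt0.
apply: (@le_trans _ _ (z^-1 ^+ 2 * (x^-1 + y^-1) ^+ 2)).
  rewrite -!exprMn lerXn2r ?nnegrE ?mulr_ge0 ?addr_ge0 ?invr_ge0 ?(ltW x0) ?(ltW y0)
    ?(ltW z0) //.
  have -> : x^-1 + y^-1 = (x + y) * (x^-1 * y^-1) by field; rewrite !gt_eqF.
  rewrite mulrA ler_peMl ?mulr_ge0 ?invr_ge0 ?(ltW x0) ?(ltW y0) //.
  by rewrite ler_pdivlMl ?mulr1.
rewrite [X in _ <= X](_ : _ = z^-1 ^+ 2 * (2 * (x^-1 ^+ 2 + y^-1 ^+ 2))); last by ring.
rewrite ler_wpM2l ?sqr_ge0 //.
by have := sqr_ge0 (x^-1 - y^-1); lra.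
Qed.

End Weights.

(** * Recovering t_0 from truncated double sums against a and its convolution inverse *)

Section Resummation.
Variables (R : realFieldType) (a e t : nat -> R).
Hypotheses (a0 : a 0 = 1) (e0 : e 0 = 1).

(** Grouped by m = n + k, the coefficient of t_m is the convolution of order m. The induction on L
    adds one antidiagonal, whose coefficient vanishes. *)
Lemma sum_convolution (L : nat) :
    (forall m, (0 < m <= L)%N -> \sum_(k < m.+1) e k * a (m - k)%N = 0) ->
  \sum_(n < L.+1) a n * \sum_(k < (L - n).+1) e k * t (n + k)%N = t 0.
Proof.
elim: L => [|L IH] conv; first by rewrite big_ord1 big_ord1 /= a0 e0 !mul1r.
rewrite big_ord_recr /= subnn big_ord1 /= /= e0 mul1r addn0.
have -> : \sum_(n < L.+1) a n * \sum_(k < (L.+1 - n).+1) e k * t (n + k)%N =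
   t 0 + \sum_(n < L.+1) a n * e (L.+1 - n)%N * t L.+1.
  rewrite -[in RHS]IH; last by move=> m /andP[m0 mL]; rewrite conv // m0 ltnW.
  rewrite -big_split /=; apply: eq_bigr => n _.
  have nL : (n <= L)%N by rewrite -ltnS.
  rewrite subSn // big_ord_recr /= mulrDr -subSn // subnKC ?mulrA //.
  exact: leqW.
rewrite -addrA -mulr_suml -mulrDl.
suff -> : \sum_(i < L.+1) a i * e (L.+1 - i)%N + a L.+1 = 0 by rewrite mul0r addr0.
have : \sum_(i < L.+2) a i * e (L.+1 - i)%N = 0.
  rewrite -{2}(conv L.+1 (leqnn _)) [RHS](reindex_inj rev_ord_inj) /=.
  apply: eq_bigr => i _.
  by rewrite subSS subKn 1?mulrC // -ltnS.
by rewrite big_ord_recr /= subnn e0 mulr1.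
Qed.

(** Letting k run up to N adds to the triangle n + k <= L only terms with k > 0. They are
    nonpositive because e_k <= 0, which gives the upper bound, and each is at least -T a_n a_k with
    n + k > L, which gives the lower one. *)
Lemma resummation_bounds (T : R) (b : nat -> nat -> R) (L N : nat) :
    (L <= N)%N ->
    (forall m, (0 < m <= L)%N -> \sum_(k < m.+1) e k * a (m - k)%N = 0) ->
    (forall n, 0 <= a n) -> (forall n, 0 <= t n <= T) ->
    (forall k, (0 < k)%N -> - a k <= e k <= 0) ->
    (forall n k, (L <= n + k)%N -> a n * a k <= b n k) ->
    (forall n k, 0 <= b n k) ->
  t 0 - T * \sum_(n < L.+1) \sum_(k < N.+1) b n k <=
  \sum_(n < L.+1) a n * \sum_(k < N.+1) e k * t (n + k)%N <= t 0.
Proof.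
move=> LN conv a_ge0 t_bnd e_bnd ab b_ge0.
have T_ge0 : 0 <= T by case/andP: (t_bnd 0) => /le_trans; apply.
rewrite -(sum_convolution conv).
have split n : (n < L.+1)%N -> \sum_(k < N.+1) e k * t (n + k)%N =
    \sum_(k < (L - n).+1) e k * t (n + k)%N + \sum_((L - n).+1 <= k < N.+1) e k * t (n + k)%N.
  move=> nL; rewrite -!(big_mkord xpredT (fun k => e k * t (n + k)%N)).
  by rewrite (big_cat_nat (n := (L - n).+1)) //= ltnS (leq_trans (leq_subr _ _)).
apply/andP; split; last first.
  apply: ler_sum => n _; rewrite ler_wpM2l // split // gerDl big_nat sumr_le0 //
    => k /andP[nk _].
  case/andP: (t_bnd (n + k)%N) => t0 _;
    case/andP: (e_bnd k (leq_ltn_trans (leq0n _) nk)) => _ e_le0.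
  exact: mulr_le0_ge0.
rewrite mulr_sumr -sumrB; apply: ler_sum => n _.
rewrite split // mulrDr lerD2l lerNl -mulrN -sumrN mulr_sumr mulr_sumr.
rewrite -[X in _ <= X](big_mkord xpredT (fun k => T * b n k)).
rewrite [X in _ <= X](big_cat_nat (n := (L - n).+1)) //=; last first.
  by rewrite ltnS (leq_trans (leq_subr _ _)).
rewrite -[X in X <= _]add0r lerD //; first by apply: sumr_ge0 => k _; rewrite mulr_ge0.
rewrite !big_nat; apply: ler_sum => k /andP[nk _].
case/andP: (t_bnd (n + k)%N) => t0 tT;
  case/andP: (e_bnd k (leq_ltn_trans (leq0n _) nk)) => ae e_le0.
have abk : a n * a k <= b n k by apply: ab; move: nk; have := ltn_ord n; lia.
rewrite -mulNr mulrA mulrC ler_pM //.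
  by rewrite mulr_ge0 // oppr_ge0.
apply: le_trans abk; rewrite ler_wpM2l //.
by rewrite lerNl.
Qed.

End Resummation.

(** * Norms on l^2 and the shift S_K *)

Section Norms.
Variable R : realType.
Implicit Types (z : nat -> R[i]) (c M r : R).
Local Open Scope complex_scope.

Lemma normc_cabs (x : R[i]) : `|x| = (cabs x)%:C.
Proof. exact: normc_def. Qed.

Lemma sqr_normc_cabs (x : R[i]) : `|x| ^+ 2 = (cabs x ^+ 2)%:C.
Proof. by rewrite normc_cabs rmorphXn. Qed.

Lemma cabs_ge0 (x : R[i]) : 0 <= cabs x.
Proof. exact: sqrtr_ge0. Qed.

Lemma cabsM (x y : R[i]) : cabs (x * y) = cabs x * cabs y.
Proof. by apply: complexI; rewrite rmorphM /= -!normc_cabs normrM. Qed.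

Lemma cabs_real c : cabs c%:C = `|c|.
Proof. by rewrite /cabs /= expr0n addr0 sqrtr_sqr. Qed.

Lemma sqr_cabsZ c (x : R[i]) : cabs (c%:C * x) ^+ 2 = c ^+ 2 * cabs x ^+ 2.
Proof. by rewrite cabsM cabs_real exprMn real_normK ?num_real. Qed.

Lemma cabs_eq0 (x : R[i]) : (cabs x == 0) = (x == 0).
Proof. by rewrite -(inj_eq (@complexI R)) -normc_cabs normr_eq0. Qed.

Lemma cabs0 : cabs (0 : R[i]) = 0.
Proof. by apply/eqP; rewrite cabs_eq0. Qed.

Lemma cabs_conj (x : R[i]) : cabs x^* = cabs x.
Proof. by case: x => u v; rewrite /cabs /= sqrrN. Qed.

(** From here on, [l2norm] is handled only through finite partial sums. *)
Lemma l2norm_le z r : 0 <= r ->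
  (l2norm z <= r%:E)%E <-> forall L, \sum_(k < L) cabs (z k) ^+ 2 <= r ^+ 2.
Proof.
move=> r0.
have sq_ge0 n : (0 <= n)%N -> true -> (0 <= (cabs (z n) ^+ 2)%:E)%E.
  by move=> _ _; rewrite lee_fin sqr_ge0.
have partial L : ((\sum_(k < L) cabs (z k) ^+ 2)%:E <= l2sq z)%E.
  by have := nneseries_lim_ge L sq_ge0; rewrite sumEFin big_mkord.
have l2_ge0 : (0 <= l2sq z)%E by apply: nneseries_ge0.
have -> : (l2norm z <= r%:E)%E = (l2sq z <= (r ^+ 2)%:E)%E.
  rewrite /l2norm; case: (l2sq z) l2_ge0 => [s|//|//]; rewrite !lee_fin => s0.
  by rewrite -(@ler_pXn2r _ 2) ?nnegrE ?sqrtr_ge0 // sqr_sqrtr.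
split=> [h L|h]; first by rewrite -lee_fin; apply: le_trans (partial L) h.
have := ereal_nondecreasing_cvgn (ereal_nondecreasing_series sq_ge0).
rewrite /l2sq => /cvg_lim -> //; apply: ge_ereal_sup => _ [L _ <-].
by rewrite sumEFin big_mkord lee_fin.
Qed.

Lemma opnorm_l2_finsupp (A : (nat -> R[i]) -> nat -> R[i]) M z (L L' : nat) :
    0 <= M -> (opnorm_l2 A <= M%:E)%E ->
    (forall c y n, A (fun k => c%:C * y k) n = c%:C * A y n) ->
    (forall k, (L <= k)%N -> z k = 0) ->
  \sum_(n < L') cabs (A z n) ^+ 2 <= M ^+ 2 * \sum_(k < L) cabs (z k) ^+ 2.
Proof.
move=> M0 A_le A_hom z0; set Z := \sum_(k < L) _.
have Z_ge0 : 0 <= Z by apply: sumr_ge0 => k _; rewrite sqr_ge0.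
have zE L2 : \sum_(k < L2) cabs (z k) ^+ 2 <= Z.
  rewrite /Z (@sum_ord_vanish _ (fun k => cabs (z k) ^+ 2) L (L2 + L)).
  - by rewrite big_split_ord lerDl sumr_ge0 // => k _; rewrite sqr_ge0.
  - by move=> k /z0 ->; rewrite cabs0 expr0n.
  - by move=> k L2k; rewrite z0 ?cabs0 ?expr0n // (leq_trans (leq_addl _ _) L2k).
(* The zero sequence cannot be normalised; being 0 times itself, it is sent to 0 by homogeneity. *)
have [Z0|Z_neq0] := eqVneq Z 0.
  have -> : z = (fun k => 0%:C * z k).
    apply/funext => k; rewrite mul0r; apply/eqP; rewrite -cabs_eq0.
    rewrite -sqrf_eq0 -[_ == 0]andbT eq_le sqr_ge0 andbT andbT -Z0.
    apply: le_trans (zE k.+1); rewrite big_ord_recr lerDr sumr_ge0 // => i _.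
    by rewrite sqr_ge0.
  rewrite Z0 mulr0 sumr_le0 // => n _.
  by rewrite A_hom mul0r cabs0 expr0n.
have Z_gt0 : 0 < Z by rewrite lt0r Z_neq0.
pose s : R := (Num.sqrt Z)^-1.
have s2 : s ^+ 2 * Z = 1 by rewrite exprVn sqr_sqrtr // mulVf.
pose sz k := s%:C * z k.
have : (l2norm (A sz) <= M%:E)%E.
  apply: le_trans A_le; apply: ereal_sup_ubound; exists sz => //=.
  apply/l2norm_le => // L2; under eq_bigr do rewrite sqr_cabsZ.
  by rewrite -mulr_sumr expr1n -s2 ler_wpM2l ?sqr_ge0.
move/(l2norm_le _ M0)/(_ L').
under eq_bigr do rewrite A_hom sqr_cabsZ.
rewrite -mulr_sumr => h.
by rewrite -[X in X <= _]mul1r -s2 mulrAC; apply: ler_wpM2r.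
Qed.

End Norms.

Section HilbertNorm.
Variables (R : realType) (H : hilbertSpace R).
Implicit Types (x y z : H) (T : H -> H).
Local Open Scope complex_scope.

Definition hsq x : R := complex.Re (hinner x x).

Lemma hinner_hsq x : hinner x x = (hsq x)%:C.
Proof. by rewrite /hsq RRe_real // ger0_real // hinner_ge0. Qed.

Lemma hsq_ge0 x : 0 <= hsq x.
Proof. by rewrite -lecR -hinner_hsq hinner_ge0. Qed.

Lemma hnorm_sqr x : hnorm x ^+ 2 = hsq x.
Proof. by rewrite sqr_sqrtr // hsq_ge0. Qed.

Lemma hinnerZl a x z : hinner (a *: x) z = a * hinner x z.
Proof. exact: (formZl (@hinner_linear R H)). Qed.

Lemma hinnerZr a x z : hinner x (a *: z) = a^* * hinner x z.
Proof. exact: (formZr (@hinner_linear R H) (@hinner_conj R H)). Qed.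

Lemma hsqZ a x : hsq (a *: x) = cabs a ^+ 2 * hsq x.
Proof.
apply: complexI; rewrite rmorphM /= -sqr_normc_cabs -!hinner_hsq.
by rewrite hinnerZl hinnerZr mulrA -sqr_normc.
Qed.

Lemma opnorm_le T (M : R) : 0 <= M ->
  (forall x, hsq (T x) <= M ^+ 2 * hsq x) -> (opnorm T <= M%:E)%E.
Proof.
move=> M0 hT; apply: ge_ereal_sup => _ [x /= x1 <-]; rewrite lee_fin.
rewrite -(@ler_pXn2r _ 2) ?nnegrE ?sqrtr_ge0 // hnorm_sqr (le_trans (hT x)) //.
rewrite ler_piMr ?sqr_ge0 // -hnorm_sqr -[X in _ <= X](expr1n _ 2).
by rewrite lerXn2r ?nnegrE ?sqrtr_ge0.
Qed.

Lemma hsq_opnorm_le T (M : R) x : (forall a x y, T (a *: x + y) = a *: T x + T y) ->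
  0 <= M -> (opnorm T <= M%:E)%E -> hsq (T x) <= M ^+ 2 * hsq x.
Proof.
move=> T_lin M0 T_le.
have T0 : T 0 = 0.
  have := T_lin 1 0 0; rewrite !scale1r addr0 => /eqP.
  by rewrite -subr_eq0 opprD addrA subrr add0r oppr_eq0 => /eqP.
have TZ a y : T (a *: y) = a *: T y by rewrite -[a *: y]addr0 T_lin T0 addr0.
have [x0|x_neq0] := eqVneq (hsq x) 0.
  have -> : x = 0 by apply: hinner_eq0; rewrite hinner_hsq x0.
  by rewrite T0 -(scale0r (0 : H)) hsqZ cabs0 expr0n mul0r mulr_ge0 ?sqr_ge0 ?hsq_ge0.
have x_gt0 : 0 < hsq x by rewrite lt0r x_neq0 hsq_ge0.
pose s : R := (Num.sqrt (hsq x))^-1.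
have s2 : s ^+ 2 * hsq x = 1 by rewrite exprVn sqr_sqrtr ?hsq_ge0 // mulVf.
have hsqsZ y : hsq (s%:C *: y) = s ^+ 2 * hsq y.
  by rewrite hsqZ cabs_real real_normK ?num_real.
have : ((hnorm (T (s%:C *: x)))%:E <= M%:E)%E.
  apply: le_trans T_le; apply: ereal_sup_ubound; exists (s%:C *: x) => //=.
  rewrite -(@ler_pXn2r _ 2) ?nnegrE ?sqrtr_ge0 //.
  by rewrite hnorm_sqr hsqsZ s2 expr1n.
rewrite lee_fin -(@ler_pXn2r _ 2) ?nnegrE ?sqrtr_ge0 // hnorm_sqr TZ hsqsZ => h.
rewrite -[X in X <= _]mul1r -s2 mulrAC.
by apply: ler_wpM2r => //; apply: hsq_ge0.
Qed.

End HilbertNorm.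

Section LinearIter.
Variables (R : realType) (H : hilbertSpace R) (T : H -> H).
Hypothesis T_lin : forall (a : R[i]) (x y : H), T (a *: x + y) = a *: T x + T y.

Lemma iter_linear n a (x y : H) : iter n T (a *: x + y) = a *: iter n T x + iter n T y.
Proof. by elim: n => //= n ->; rewrite T_lin. Qed.

Lemma iter_linear0 n : iter n T (0 : H) = 0.
Proof.
have := iter_linear n 1 0 0; rewrite !scale1r addr0 => /eqP.
by rewrite -subr_eq0 opprD addrA subrr add0r oppr_eq0 => /eqP.
Qed.

Lemma iter_linear_sum n m (c : 'I_m -> R[i]) (v : 'I_m -> H) :
  iter n T (\sum_i c i *: v i) = \sum_i c i *: iter n T (v i).
Proof.
elim/big_rec2: _ => [|i y x _ <-]; first exact: iter_linear0.
exact: iter_linear.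
Qed.

Lemma iter_polyop (p : {poly R[i]}) n (x : H) (N : nat) : (size p <= N)%N ->
  iter n T (polyop p T x) = \sum_(i < N) p`_i *: iter (n + i) T x.
Proof.
move=> pN; rewrite /polyop iter_linear_sum.
rewrite (@sum_ord_vanish _ (fun i => p`_i *: iter n T (iter i T x)) (size p) N).
- by apply: eq_bigr => i _; rewrite iterD.
- by move=> i pi; rewrite nth_default ?scale0r.
- by move=> i Ni; rewrite nth_default ?scale0r // (leq_trans pN).
Qed.

End LinearIter.

(** * Polynomials of S_K as lower triangular matrices *)

Section ShiftDomination.
Variables (R : realType) (K : R).
Hypothesis K_gt1 : 1 < K.
Local Open Scope complex_scope.

Lemma iter_S_K i z n : iter i (S_K K) z n =
  if (i <= n)%N then (betaK K n / betaK K (n - i))%:C * z (n - i)%N else 0.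
Proof.
have b0 m := lt0r_neq0 (betaK_gt0 K_gt1 m).
elim: i z n => [|i IH] z n; first by rewrite /= subn0 divff // mul1r.
case: n => [|n] //=; rewrite IH ltnS subSS; case: ifP => _; last by rewrite mulr0.
rewrite mulrA -rmorphM /=; congr (_%:C * _).
rewrite mulrA; congr (_ / _); rewrite /alphaK -(natr1 n) addrK natr1.
by rewrite -/(betaK K n) divfK.
Qed.

(** The (n, j) entry of p(S_K) is p_{n-j} beta_n / beta_j. The free range [m] lets one finite matrix
    serve for all rows. *)
Lemma polyop_seq_S_K (p : {poly R[i]}) z n m : (n < m)%N -> polyop_seq p (S_K K) z n =
  \sum_(j < m) if (j <= n)%N then
    p`_(n - j) * (betaK K n / betaK K j)%:C * z j else 0.
Proof.
move=> nm; rewrite /polyop_seq.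
rewrite (@sum_ord_vanish _ (fun i =>
  p`_i * iter i (S_K K) z n) (size p) (size p + n.+1)); first last.
- by move=> i h; rewrite nth_default ?mul0r // (leq_trans (leq_addr _ _) h).
- by move=> i h; rewrite nth_default ?mul0r.
rewrite (@sum_ord_vanish _ (fun i => p`_i * iter i (S_K K) z n) _ n.+1); first last.
- by move=> i h; rewrite iter_S_K leqNgt h mulr0.
- by move=> i h; rewrite nth_default ?mul0r // (leq_trans (leq_addr _ _) h).
rewrite (@sum_ord_vanish _ (fun j => if (j <= n)%N then
  p`_(n - j) * (betaK K n / betaK K j)%:C * z j else 0) m n.+1); first last.
- by move=> i h; rewrite leqNgt h.
- by move=> i h; rewrite leqNgt (leq_trans nm h).
rewrite (reindex_inj rev_ord_inj) /=; apply: eq_bigr => j _.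
have jn : (j <= n)%N by rewrite -ltnS.
by rewrite iter_S_K subSS leq_subr jn subKn // mulrA.
Qed.

Lemma polyop_seq_S_K_hom (p : {poly R[i]}) c z n :
  polyop_seq p (S_K K) (fun k => c%:C * z k) n = c%:C * polyop_seq p (S_K K) z n.
Proof.
rewrite !(polyop_seq_S_K _ _ (ltnSn n)) mulr_sumr; apply: eq_bigr => j _.
by case: ifP => _; rewrite ?mulr0 // mulrCA.
Qed.

(* The matrix is a finite section of the transpose of p(S_K); pairing its image
   with a test vector moves the operator back to p(S_K). *)
Lemma S_K_transpose_bound (p : {poly R[i]}) (M : R) L N (z : 'I_N.+1 -> R[i]) :
    0 < M -> (opnorm_l2 (polyop_seq p (S_K K)) <= M%:E)%E ->
  \sum_(j < L.+1) `|\sum_(m < N.+1)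
      (if (j <= m)%N then p`_(m - j) * (betaK K m / betaK K j)%:C else 0) * z m| ^+ 2
  <= (M ^+ 2)%:C * \sum_m `|z m| ^+ 2.
Proof.
move=> M0 M_le.
pose B (m j : nat) := if (j <= m)%N then p`_(m - j) * (betaK K m / betaK K j)%:C else 0.
pose y (j : nat) := \sum_(m < N.+1) B m j * z m.
pose w k := if (k < L.+1)%N then (y k)^* else 0.
pose u := polyop_seq p (S_K K) w.
have uE m : u m = \sum_(j < L.+1) B m j * (y j)^*.
  rewrite /u (@polyop_seq_S_K _ _ _ (m.+1 + L.+1)) ?leq_addr //.
  rewrite (@sum_ord_vanish _ (fun j => if (j <= m)%N then
      p`_(m - j) * (betaK K m / betaK K j)%:C * w j else 0) _ L.+1); first last.
  - by move=> i h; rewrite /w ltnNge h mulr0 if_same.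
  - by move=> i h; rewrite leqNgt (leq_trans (leq_addr _ _) h).
  by apply: eq_bigr => j _; rewrite /w /B ltn_ord; case: ifP; rewrite ?mul0r.
have U_le : \sum_(m < N.+1) `|u m| ^+ 2 <= (M ^+ 2)%:C * \sum_(j < L.+1) `|y j| ^+ 2.
  have w0 k : (L < k)%N -> w k = 0 by move=> Lk; rewrite /w ltnNge Lk.
  have := opnorm_l2_finsupp N.+1 (ltW M0) M_le (polyop_seq_S_K_hom p) w0.
  rewrite -lecR rmorphM !rmorph_sum /=.
  under eq_bigr do rewrite -sqr_normc_cabs.
  congr (_ <= _ * _); apply: eq_bigr => j _.
  by rewrite /w ltn_ord cabs_conj -sqr_normc_cabs.
have YE : \sum_(j < L.+1) `|y j| ^+ 2 = \sum_m z m * u m.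
  under [RHS]eq_bigr do rewrite uE mulr_sumr; rewrite exchange_big /=.
  apply: eq_bigr => j _; rewrite sqr_normc [X in X * _]/y mulr_suml.
  by apply: eq_bigr => m _; rewrite mulrCA mulrA.
change (\sum_(j < L.+1) `|y j| ^+ 2 <= (M ^+ 2)%:C * \sum_m `|z m| ^+ 2).
set Y : R[i] := \sum_(j < L.+1) _ in U_le YE *; set Z : R[i] := \sum_m `|z m| ^+ 2.
have Y_real : Y^* = Y.
  have : Y \is Num.real by rewrite ger0_real // sumr_ge0 // => j _; rewrite exprn_ge0.
  by case/complex_realP => k ->; apply: conjc_real.
have YEc : Y = \sum_m (z m)^* * (u m)^*.
  by rewrite -Y_real YE rmorph_sum; apply: eq_bigr => m _; rewrite rmorphM.
have t_real : ((M ^+ 2)%:C)^* = (M ^+ 2)%:C by rewrite conjc_real.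
have t_gt0 : 0 < (M ^+ 2)%:C by rewrite ltcR exprn_gt0.
move: ((M ^+ 2)%:C : R[i]) t_real t_gt0 U_le => t t_real t_gt0 U_le.
(* This square replaces Cauchy-Schwarz: with U the sum of the |u_m|^2, it expands to t^2 Z - 2tY + U
   >= 0, and U <= tY leaves tY <= t^2 Z. *)
have : 0 <= \sum_m `|t * (z m)^* - u m| ^+ 2 by rewrite sumr_ge0 // => m _; rewrite exprn_ge0.
have -> : \sum_m `|t * (z m)^* - u m| ^+ 2 =
    t ^+ 2 * Z - t * (Y + Y) + \sum_(m < N.+1) `|u m| ^+ 2.
  rewrite {1}YE YEc /Z -big_split !mulr_sumr -sumrB -big_split /=.
  apply: eq_bigr => m _; rewrite !sqr_normc rmorphB !rmorphM /= conjcK t_real; ring.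
move=> h; rewrite -(ler_pM2l t_gt0) -subr_ge0.
apply: le_trans h _; rewrite -subr_ge0.
rewrite (_ : _ - _ = t * Y - \sum_(m < N.+1) `|u m| ^+ 2) ?subr_ge0 //.
by ring.
Qed.

End ShiftDomination.

(** * Power bounded operators *)

Lemma le_of_inv_bound (R : archiRealFieldType) (X Y c : R) : 0 <= c ->
  (forall L : nat, X <= Y + c * L.+1%:R^-1) -> X <= Y.
Proof.
move=> c0 h; rewrite leNgt; apply/negP => YX.
have d0 : 0 < X - Y by rewrite subr_gt0.
have := archi_boundP (divr_ge0 c0 (ltW d0)); set L := Num.bound _ => hL.
have L1 : 0 < L.+1%:R :> R by rewrite ltr0n.
have := h L; rewrite leNgt => /negP; apply; rewrite -ltrBrDl ltr_pdivrMr //.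
rewrite -ltr_pdivrMl // mulrC; apply: lt_trans hL _.
by rewrite ltr_nat.
Qed.

Section PowerBounded.
Variables (R : realType) (K : R) (H : hilbertSpace R) (T : H -> H).
Hypotheses (K_gt1 : 1 < K)
  (T_lin : forall (a : R[i]) (x y : H), T (a *: x + y) = a *: T x + T y)
  (T_pb : forall n x, hsq (iter n T x) <= K ^+ 2 * hsq x).
Local Open Scope complex_scope.

(** The form q of the renorming argument, truncated at order [N]. *)
Definition orbit_form (e : nat -> R) (N : nat) (x y : H) : R[i] :=
  \sum_(k < N.+1) (e k)%:C * hinner (iter k T x) (iter k T y).

Lemma orbit_form_linear e N a x y z :
  orbit_form e N (a *: x + y) z = a * orbit_form e N x z + orbit_form e N y z.
Proof.
rewrite /orbit_form mulr_sumr -big_split; apply: eq_bigr => k _ /=.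
by rewrite iter_linear // hinner_linear mulrDr mulrCA.
Qed.

Lemma orbit_form_conj e N x y : orbit_form e N y x = (orbit_form e N x y)^*.
Proof.
rewrite /orbit_form rmorph_sum; apply: eq_bigr => k _ /=.
rewrite rmorphM; congr (_ * _); last exact: hinner_conj.
by rewrite /= oppr0.
Qed.

Lemma orbit_form_iter e N n x : orbit_form e N (iter n T x) (iter n T x) =
  (\sum_(k < N.+1) e k * hsq (iter (n + k) T x))%:C.
Proof.
rewrite rmorph_sum; apply: eq_bigr => k _.
by rewrite -!iterD hinner_hsq -rmorphM addnC.
Qed.

(** The term |x|^2 of index 0 absorbs all the others, which sum to at least -K^2 (a_1 + ... + a_N)
    |x|^2. *)
Lemma orbit_form_ge0 e N x : e 0 = 1 ->
    (forall k, (0 < k)%N -> - sqweight K k <= e k <= 0) ->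
  0 <= orbit_form e N x x.
Proof.
move=> e0 e_bnd; have := orbit_form_iter e N 0 x; rewrite /= => ->.
rewrite ler0c big_ord_recl e0 mul1r /=.
have : \sum_(i < N) - (sqweight K i.+1 * (K ^+ 2 * hsq x)) <=
    \sum_(i < N) e (bump 0 i) * hsq (iter (0 + bump 0 i) T x).
  apply: ler_sum => i _; rewrite -mulNr.
  have /andP[le_e e_le0] := e_bnd i.+1 isT.
  apply: (@le_trans _ _ (e i.+1 * (K ^+ 2 * hsq x))).
    by rewrite ler_wpM2r // mulr_ge0 ?sqr_ge0 ?hsq_ge0.
  by rewrite ler_wnM2l.
rewrite sumrN -mulr_suml => h; rewrite -(lerD2l (hsq x)) in h.
apply: le_trans h; rewrite subr_ge0 mulrA ler_piMl ?hsq_ge0 //.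
by rewrite mulrC sum_sqweight_le.
Qed.

(** The transposed matrix of p(S_K) is applied to the vectors v_m = T^m x / beta_m. Its row j gives
    T^j p(T) x / beta_j exactly as long as j + deg p <= N, hence the condition relating [L], [N] and
    [size p]. *)
Lemma orbit_form_polyop e N L (p : {poly R[i]}) (M : R) x :
    e 0 = 1 -> (forall k, (0 < k)%N -> - sqweight K k <= e k <= 0) ->
    (L + size p <= N)%N ->
    0 < M -> (opnorm_l2 (polyop_seq p (S_K K)) <= M%:E)%E ->
  \sum_(j < L.+1) sqweight K j * \sum_(k < N.+1) e k * hsq (iter (j + k) T (polyop p T x)) <=
  M ^+ 2 * \sum_(m < N.+1) sqweight K m * \sum_(k < N.+1) e k * hsq (iter (m + k) T x).
Proof.
move=> e0 e_bnd LN M0 M_le.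
pose q := orbit_form e N.
pose v (m : 'I_N.+1) := ((betaK K m)^-1)%:C *: iter m T x.
have q_lin := @orbit_form_linear e N; have q_conj := @orbit_form_conj e N.
have := form_dominated q_lin q_conj (fun x => @orbit_form_ge0 e N x e0 e_bnd) v
  (fun z => @S_K_transpose_bound R K K_gt1 p M L N z M0 M_le).
have sqwE (j : nat) (y : H) : q (((betaK K j)^-1)%:C *: y) (((betaK K j)^-1)%:C *: y) =
    (sqweight K j)%:C * q y y.
  rewrite /q (formZl q_lin) (formZr q_lin q_conj) mulrA.
  by rewrite conjc_real -rmorphM -expr2.
move=> dom; rewrite -lecR rmorphM !rmorph_sum; move: dom; congr (_ <= _ * _); last first.
  by apply: eq_bigr => m _; rewrite [LHS](sqwE m) [RHS]rmorphM /q orbit_form_iter.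
apply: eq_bigr => j _; set y := polyop p T x.
transitivity ((sqweight K j)%:C * q (iter j T y) (iter j T y)); last first.
  by rewrite [RHS]rmorphM /q orbit_form_iter.
rewrite -sqwE.
suff -> : \sum_(i < N.+1) (if (j <= i)%N then
    p`_(i - j) * (betaK K i / betaK K j)%:C else 0) *: v i =
    ((betaK K j)^-1)%:C *: iter j T y by [].
have jL : (j <= L)%N by rewrite -ltnS.
rewrite /y (@iter_polyop _ _ _ T_lin p j x (N - j).+1); last by lia.
pose f i := (if (j <= i)%N then p`_(i - j) * (betaK K i / betaK K j)%:C else 0) *: 
   (((betaK K i)^-1)%:C *: iter i T x).
rewrite -/(\sum_(i < N.+1) f i) -(big_mkord xpredT f).
(* Indices below j contribute nothing; shifting the others by j turns the sum into p(T) applied to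
   T^j x. *)
rewrite (big_cat_nat (n := j)) //=; last by lia.
rewrite big_nat big1 ?add0r; last first.
  by move=> i /andP[_ ij]; rewrite /f leqNgt ij scale0r.
rewrite -{1}[j : nat]add0n big_addn big_mkord scaler_sumr subSn; last by lia.
apply: eq_bigr => i _; rewrite /f leq_addl addnK !scalerA addnC; congr (_ *: _).
rewrite -mulrA mulrC; congr (_ * _); rewrite -rmorphM mulrAC mulfV ?mul1r //.
by rewrite lt0r_neq0 // betaK_gt0.
Qed.

Lemma tail_sum_le (L d : nat) :
  \sum_(n < L.+1) \sum_(k < (L + d).+1)
     2 * L.+1%:R^-1 ^+ 2 * (n.+1%:R^-1 ^+ 2 + k.+1%:R^-1 ^+ 2) <=
  (4 * (d + 2)%:R) * L.+1%:R^-1 :> R.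
Proof.
under eq_bigr do rewrite -mulr_sumr big_split /= sumr_const card_ord.
rewrite -mulr_sumr big_split /= sumr_const card_ord sumrMnl.
set s1 := \sum_(i < L.+1) _; set s2 := \sum_(i < (L + d).+1) _.
have h1 : s1 <= 2 by apply: sum_inv_sqr.
have h2 : s2 <= 2 by apply: sum_inv_sqr.
have L0 : 0 < L.+1%:R :> R by rewrite ltr0n.
apply: (@le_trans _ _ (2 * L.+1%:R^-1 ^+ 2 * (2 *+ (L + d).+1 + 2 *+ L.+1))).
  by rewrite ler_wpM2l ?mulr_ge0 ?sqr_ge0 // lerD // lerMn2r ?h1 ?h2 orbT.
apply: (@le_trans _ _ (2 * L.+1%:R^-1 ^+ 2 * (2 * (d + 2)%:R * L.+1%:R))).
  rewrite ler_wpM2l ?mulr_ge0 ?sqr_ge0 //.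
  have -> : 2 *+ (L + d).+1 + 2 *+ L.+1 = (2 * ((L + d).+1 + L.+1))%:R :> R.
    by rewrite -mulrnDr natrM mulr_natr.
  have -> : 2 * (d + 2)%:R * L.+1%:R = (2 * (d + 2) * L.+1)%:R :> R by rewrite !natrM.
  by rewrite ler_nat; nia.
by rewrite le_eqVlt; apply/orP; left; apply/eqP; field; rewrite lt0r_neq0.
Qed.

(** Resummation on both sides of the domination turns it into |p(T)x|^2 - O(1/L) <= M^2 |x|^2, and L
    is arbitrary. *)
Lemma hsq_polyop_le (p : {poly R[i]}) (M : R) x :
    0 < M -> (opnorm_l2 (polyop_seq p (S_K K)) <= M%:E)%E ->
  hsq (polyop p T x) <= M ^+ 2 * hsq x.
Proof.
move=> M0 M_le; set y := polyop p T x; set d := size p.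
apply: (@le_of_inv_bound _ _ _ (K ^+ 2 * hsq y * (4 * (d + 2)%:R))).
  by rewrite mulr_ge0 // mulr_ge0 ?sqr_ge0 ?hsq_ge0.
move=> L; pose N := (L + d)%N.
have a0 : sqweight K 0 = 1 by rewrite /sqweight /betaK mulr0 add0r invr1 expr1n.
have [e [e0 e_bnd e_conv]] := kaluza N a0 (sqweight_gt0 K_gt1)
  (@sqweight_log_convex _ _ K_gt1).
have a_ge0 n : 0 <= sqweight K n by rewrite ltW // sqweight_gt0.
pose b (L n k : nat) : R := 2 * L.+1%:R^-1 ^+ 2 * (n.+1%:R^-1 ^+ 2 + k.+1%:R^-1 ^+ 2).
have b_ge0 L' n k : 0 <= b L' n k by rewrite /b mulr_ge0 ?addr_ge0 ?sqr_ge0 //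
  mulr_ge0 ?sqr_ge0.
have ab L' n k : (L' <= n + k)%N -> sqweight K n * sqweight K k <= b L' n k.
  exact: sqweight_pair_le.
have t_bnd z n : 0 <= hsq (iter n T z) <= K ^+ 2 * hsq z by rewrite hsq_ge0 T_pb.
have LN : (L <= N)%N by apply: leq_addr.
have convL m : (0 < m <= L)%N -> \sum_(k < m.+1) e k * sqweight K (m - k)%N = 0.
  by move=> /andP[m0 mL]; rewrite e_conv // m0 (leq_trans mL).
(* For y = p(T)x the outer sum stops at L, where the intertwining is exact, and the lower bound
   costs an error. For x the upper bound at N has no error. *)
have /andP[low _] := resummation_bounds a0 e0 LN convL a_ge0 (t_bnd y) e_bnd (ab L) (b_ge0 L).
have /andP[_ up] := resummation_bounds a0 e0 (leqnn N) e_conv a_ge0 (t_bnd x) e_bnd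
  (ab N) (b_ge0 N).
have mid := orbit_form_polyop x e0 e_bnd (leqnn N) M0 M_le.
rewrite -lerBlDr -(mulrA (K ^+ 2 * hsq y)); apply: le_trans (le_trans low (le_trans mid _)).
  rewrite lerD2l lerN2 ler_wpM2l ?tail_sum_le //.
  by rewrite mulr_ge0 ?sqr_ge0 ?hsq_ge0.
by rewrite ler_wpM2l ?sqr_ge0.
Qed.

End PowerBounded.

Lemma S_K_dominates (R : realType) (K : R) (H : hilbertSpace R) (T : H -> H) :
    1 < K -> (forall (a : R[i]) (x y : H), T (a *: x + y) = a *: T x + T y) ->
    (forall n : nat, (opnorm (iter n T) <= K%:E)%E) ->
  forall p : {poly R[i]}, (opnorm (polyop p T) <= opnorm_l2 (polyop_seq p (S_K K)))%E.
Proof.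
move=> K_gt1 T_lin T_pb p.
have K0 : 0 <= K by rewrite ltW // (lt_trans ltr01).
have hT n x : hsq (iter n T x) <= K ^+ 2 * hsq x.
  by apply: hsq_opnorm_le => // a u v; apply: iter_linear.
pose z0 : nat -> R[i] := fun=> 0.
have op_ge0 : (0 <= opnorm_l2 (polyop_seq p (S_K K)))%E.
  apply: (@le_trans _ _ (l2norm (polyop_seq p (S_K K) z0))).
    rewrite /l2norm.
    have : (0 <= l2sq (polyop_seq p (S_K K) z0))%E.
      by apply: nneseries_ge0 => n _ _; rewrite lee_fin sqr_ge0.
    by case: l2sq => // r _; rewrite lee_fin sqrtr_ge0.
  apply: ereal_sup_ubound; exists z0 => //=.
  apply/l2norm_le => [|L]; first exact: ler01.
  rewrite big1; first by rewrite expr1n ler01.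
  by move=> k _; rewrite /z0 cabs0 expr0n.
case E : (opnorm_l2 _) op_ge0 => [M| |] //; last by rewrite !leey.
(* The norm of p(S_K) may be 0, while the transposed bound cancels a factor M^2; adding eps makes
   the bound strictly positive. *)
rewrite lee_fin => M0; apply/lee_addgt0Pr => eps eps0.
have Me : 0 < M + eps by rewrite ltr_wpDl.
rewrite -EFinD; apply: opnorm_le (ltW Me) _ => x.
apply: (hsq_polyop_le K_gt1 T_lin hT) => //.
by rewrite E lee_fin lerDl ltW.
Qed.

(** * Polynomials of a power bounded weighted shift *)

Section ShapiroPair.
Variable R : realType.
Implicit Types (d : R) (k : nat).
Local Open Scope complex_scope.

(** The shift of step k is chosen so that the leading term of the second component, of degree
    2^(k-1), or 0 when k = 0, lands at 2^k. *)
Definition lacunary_step k : nat := if k is k'.+1 then (2 ^ k')%N else 1%N.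

Fixpoint shapiro_pair d k : {poly R[i]} * {poly R[i]} :=
  if k is k'.+1 then
    let fg := shapiro_pair d k' in
    (fg.1 + d%:C *: ('X^(lacunary_step k') * fg.2),
     'X^(lacunary_step k') * fg.2 - d%:C *: fg.1)
  else (0, 1).

Lemma lacunary_stepD k : (lacunary_step k + (if k is k'.+1 then 2 ^ k' else 0) = 2 ^ k)%N.
Proof. by case: k => //= k; rewrite expnS; lia. Qed.

(* The frequencies added to the first component at step k lie in
   (2^(k-1), 2^k], with coefficient d at 2^k. *)
Lemma shapiro_pair_coef d k :
  let fg := shapiro_pair d k in
  let t := (if k is k'.+1 then 2 ^ k' else 0)%N in
  [/\ fg.1`_0 = 0,
      forall i, (t < i)%N -> fg.1`_i = 0 /\ fg.2`_i = 0,
      fg.2`_t = 1, (0 < k)%N -> fg.2`_0 = 0 &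
      forall j, fg.1`_(2 ^ j) = if (j < k)%N then d%:C else 0].
Proof.
elim: k => [|k IH] /=.
  split=> //; rewrite ?coef0 ?coef1 //.
  - by move=> i i0; rewrite coef0 coef1 gtn_eqF.
  - by move=> j; rewrite coef0.
move: IH; set f := (shapiro_pair d k).1; set g := (shapiro_pair d k).2.
set t := (if k is k'.+1 then _ else _)%N => -[f0 fg_big g_lead g0 f_lac].
have stepD := lacunary_stepD k; rewrite -/t in stepD.
have s_gt0 : (0 < lacunary_step k)%N by case: (k) => //= k'; rewrite expn_gt0.
have f_lead : f`_(2 ^ k) = 0 by rewrite f_lac ltnn.
split.
- by rewrite coefD coefZ coefXnM s_gt0 f0 mulr0 addr0.
- move=> i ki; have ti : (t < i)%N by lia.
  have [_ gi] : f`_(i - lacunary_step k) = 0 /\ g`_(i - lacunary_step k) = 0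
    by apply: fg_big; lia.
  rewrite !(coefD, coefN, coefZ, coefXnM) ltnNge (_ : (lacunary_step k <= i)%N) /=;
    last by lia.
  by have [-> _] := fg_big i ti; rewrite gi !mulr0 subrr addr0.
- rewrite coefB coefZ coefXnM f_lead mulr0 subr0 -stepD ltnNge leq_addr /=.
  by rewrite addKn.
- by rewrite coefB coefZ coefXnM s_gt0 f0 mulr0 subrr.
move=> j; rewrite coefD coefZ coefXnM f_lac ltnS.
have [kj|jk|<-] := ltngtP k j.
- have h : (2 ^ k < 2 ^ j)%N by rewrite ltn_exp2l.
  rewrite ltnNge (_ : (lacunary_step k <= 2 ^ j)%N) /=; last by lia.
  have [_ ->] : f`_(2 ^ j - lacunary_step k) = 0 /\ g`_(2 ^ j - lacunary_step k) = 0.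
    by apply: fg_big; lia.
  by rewrite mulr0 addr0.
- have : (2 ^ j <= lacunary_step k)%N.
    by case: (k) jk => // k' jk /=; rewrite leq_exp2l.
  rewrite leq_eqVlt => /orP[/eqP<-|->]; last by rewrite mulr0 addr0.
  by rewrite ltnn subnn g0 ?mulr0 ?addr0 // (leq_ltn_trans _ jk).
- rewrite add0r ltnNge (_ : (lacunary_step k <= 2 ^ k)%N) /=; last by lia.
  by rewrite -stepD addKn g_lead mulr1.
Qed.

End ShapiroPair.

(** Used as an upper bound: (1 + x)^n <= 2 as soon as nx <= 1/2. *)
Lemma bernoulli_bound (R : realFieldType) (x : R) n : 0 <= x ->
  (1 + x) ^+ n * (1 - n%:R * x) <= 1.
Proof.
move=> x0; elim: n => [|n IH]; first by rewrite expr0 mul0r subr0 mulr1.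
apply: le_trans IH; rewrite exprSr -mulrA ler_wpM2l ?exprn_ge0 ?addr_ge0 //.
rewrite -natr1 -subr_ge0 (_ : _ - _ = (n%:R + 1) * x ^+ 2); last by ring.
by rewrite mulr_ge0 ?sqr_ge0.
Qed.

(** * An equivalent norm making a power bounded weighted shift a contraction *)

Section WeightedShift.
Variables (R : realType) (w : nat -> R[i]) (M : R).
Hypothesis w_pb : forall n, (opnorm_l2 (iter n (wshift w)) <= M%:E)%E.
Local Open Scope complex_scope.
Implicit Type z : nat -> R[i].

Lemma iter_wshift m z n :
  iter m (wshift w) z (n + m)%N = (\prod_(j < m) w (n + j).+1) * z n.
Proof.
elim: m => [|m IH]; first by rewrite addn0 big_ord0 mul1r.
by rewrite addnS iterS /= IH big_ord_recr /= mulrA (mulrC (w _)).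
Qed.

Definition weight_prod n m : R := \prod_(j < m) cabs (w (n + j).+1).

(** This product is the modulus of the entry of the m-th power of the shift from coordinate n to n +
    m, so the n-th basis vector tests it. *)
Lemma weight_prod_le n m : weight_prod n m <= Num.max M 1.
Proof.
set C := Num.max M 1.
have C0 : 0 <= C by rewrite /C le_max ler01 orbT.
pose z k : R[i] := (k == n)%:R.
have z1 : (l2norm z <= 1%:E)%E.
  apply/l2norm_le => [|L]; first exact: ler01.
  rewrite expr1n; apply: (@le_trans _ _ (\sum_(k < L) (k == n :> nat)%:R)).
    apply: ler_sum => k _; rewrite /z; case: eqP => _; last by rewrite cabs0 expr0n.
    by rewrite (_ : 1%:R = 1%:C) // cabs_real normr1 expr1n.
  have [nL|Ln] := ltnP n L.
    rewrite (bigD1 (Ordinal nL)) //= eqxx big1 ?addr0 // => k kn.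
    by case: eqP => // kE; case/eqP: kn; apply: val_inj.
  by rewrite big1 // => k _; rewrite ltn_eqF // (leq_trans (ltn_ord k)).
have : (l2norm (iter m (wshift w) z) <= C%:E)%E.
  apply: (@le_trans _ _ (opnorm_l2 (iter m (wshift w)))).
    by apply: ereal_sup_ubound; exists z.
  by apply: le_trans (w_pb m) _; rewrite lee_fin /C le_max lexx.
move/(l2norm_le _ C0)/(_ (n + m).+1); rewrite big_ord_recr /= iter_wshift /z eqxx mulr1.
move=> h; rewrite -(@ler_pXn2r _ 2) ?nnegrE //; last first.
  by apply: prodr_ge0 => j _; apply: cabs_ge0.
apply: le_trans h; rewrite -[X in X <= _]add0r lerD ?sumr_ge0 // => [k _|].
  by rewrite sqr_ge0.
rewrite /weight_prod (big_morph (@cabs R) (@cabsM R) (_ : _ = 1)) //.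
by rewrite (_ : 1 = 1%:C) // cabs_real normr1.
Qed.

(** The weights d_n of the equivalent norm. They lie between 1 (empty product) and [Num.max M 1]. *)
Definition shields_weight n : R := sup [set weight_prod n m | m in [set: nat]].

Lemma has_sup_weight_prod n : has_sup [set weight_prod n m | m in [set: nat]].
Proof.
split; first by exists (weight_prod n 0), 0%N.
by exists (Num.max M 1) => _ [m _ <-]; apply: weight_prod_le.
Qed.

Lemma weight_prod_le_shields n m : weight_prod n m <= shields_weight n.
Proof. by apply: ub_le_sup; [case: (has_sup_weight_prod n)|exists m]. Qed.

Lemma shields_weight_ge1 n : 1 <= shields_weight n.
Proof. by have := weight_prod_le_shields n 0; rewrite /weight_prod big_ord0. Qed.

Lemma shields_weight_le n : shields_weight n <= Num.max M 1.
Proof.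
apply: ge_sup; first by case: (has_sup_weight_prod n).
by move=> _ [m _ <-]; apply: weight_prod_le.
Qed.

(** The left side is the supremum of the products starting at n that have at least one factor. This
    inequality is exactly contractivity for the weighted norm. *)
Lemma shields_weightS n : cabs (w n.+1) * shields_weight n.+1 <= shields_weight n.
Proof.
have [->|w0] := eqVneq (cabs (w n.+1)) 0.
  by rewrite mul0r (le_trans ler01) ?shields_weight_ge1.
have w_gt0 : 0 < cabs (w n.+1) by rewrite lt0r w0 cabs_ge0.
rewrite mulrC -ler_pdivlMr //; apply: ge_sup; first by case: (has_sup_weight_prod n.+1).
move=> _ [m _ <-]; rewrite ler_pdivlMr // mulrC.
apply: le_trans (weight_prod_le_shields n m.+1).
rewrite /weight_prod big_ord_recl /= addn0 ler_wpM2l ?cabs_ge0 //.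
by apply: ler_prod => j _; rewrite cabs_ge0 /= /bump /= add1n addnS.
Qed.

(** Squared norm cut to the first [L] coordinates. A forward shift never brings later coordinates
    back, so it contracts each truncation. *)
Definition shields_norm L z : R :=
  \sum_(n < L) shields_weight n ^+ 2 * cabs (z n) ^+ 2.

Lemma shields_norm_shift L z : shields_norm L (wshift w z) <= shields_norm L z.
Proof.
rewrite /shields_norm; case: L => [|L]; first by rewrite !big_ord0.
rewrite big_ord_recl /= cabs0 expr0n mulr0 add0r big_ord_recr /=.
rewrite -[X in X <= _]addr0 lerD //; last by rewrite mulr_ge0 ?sqr_ge0.
apply: ler_sum => n _; rewrite cabsM exprMn mulrA ler_wpM2r ?sqr_ge0 //.
have d_ge0 m : 0 <= shields_weight m := le_trans ler01 (shields_weight_ge1 m).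
rewrite -exprMn lerXn2r ?nnegrE ?mulr_ge0 ?cabs_ge0 //.
by rewrite mulrC shields_weightS.
Qed.

Lemma shields_norm_iter L s z : shields_norm L (iter s (wshift w) z) <= shields_norm L z.
Proof. by elim: s => //= s; apply: le_trans (shields_norm_shift _ _). Qed.

Lemma polyop_seqE (p : {poly R[i]}) (A : (nat -> R[i]) -> nat -> R[i]) z N n :
  (size p <= N)%N -> polyop_seq p A z n = \sum_(i < N) p`_i * iter i A z n.
Proof.
move=> pN; apply: (@sum_ord_vanish _ (fun i => p`_i * iter i A z n)) => i h.
- by rewrite nth_default ?mul0r.
- by rewrite nth_default ?mul0r // (leq_trans pN).
Qed.

Lemma polyop_seqDZ (p q : {poly R[i]}) A z n c :
  polyop_seq (p + c *: q) A z n = polyop_seq p A z n + c * polyop_seq q A z n.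
Proof.
rewrite !(@polyop_seqE _ _ _ (maxn (size p) (size q))) ?leq_maxl ?leq_maxr //; last first.
  apply: leq_trans (size_polyD _ _) _; rewrite geq_max leq_maxl /=.
  by rewrite (leq_trans (size_scale_leq _ _)) // leq_maxr.
rewrite mulr_sumr -big_split; apply: eq_bigr => i _ /=.
by rewrite coefD coefZ mulrDl mulrA.
Qed.

Lemma polyop_seqX (p : {poly R[i]}) z :
  polyop_seq ('X * p) (wshift w) z = wshift w (polyop_seq p (wshift w) z).
Proof.
apply/funext => n; rewrite (@polyop_seqE _ _ _ (size p).+1); last first.
  by rewrite mulrC; have [->|p0] := eqVneq p 0; rewrite ?mul0r ?size_poly0 // size_mulX.
rewrite big_ord_recl coefXM mul0r add0r; case: n => [|n] /=.
  by rewrite big1 // => i _; rewrite mulr0.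
rewrite (@polyop_seqE _ _ _ (size p)) // mulr_sumr; apply: eq_bigr => i _.
by rewrite coefXM /= mulrCA.
Qed.

Lemma polyop_seqXn (p : {poly R[i]}) s z :
  polyop_seq ('X^s * p) (wshift w) z = iter s (wshift w) (polyop_seq p (wshift w) z).
Proof.
by elim: s => [|s IH]; rewrite ?expr0 ?mul1r // exprS -mulrA polyop_seqX IH.
Qed.

Lemma sqr_cabs_parallelogram (x y : R[i]) (d : R) :
  cabs (x + d%:C * y) ^+ 2 + cabs (y - d%:C * x) ^+ 2 =
  (1 + d ^+ 2) * (cabs x ^+ 2 + cabs y ^+ 2).
Proof.
case: x y => a b [a' b']; rewrite /cabs !sqr_sqrtr ?addr_ge0 ?sqr_ge0 //=.
ring.
Qed.

(** Each step of the recursion multiplies the sum of the two squared norms by at most 1 + d^2: the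
    parallelogram law holds coordinate by coordinate, and the power of the shift in front of the
    second component is a contraction. *)
Lemma shields_norm_shapiro d L k z :
  shields_norm L (polyop_seq (shapiro_pair d k).1 (wshift w) z) +
  shields_norm L (polyop_seq (shapiro_pair d k).2 (wshift w) z) <=
  (1 + d ^+ 2) ^+ k * shields_norm L z.
Proof.
have d0 : 0 <= 1 + d ^+ 2 by rewrite addr_ge0 ?sqr_ge0.
elim: k => [|k IH] /=.
  rewrite mul1r [X in X + _]big1 ?add0r.
    rewrite le_eqVlt; apply/orP; left; apply/eqP; apply: eq_bigr => n _.
    by rewrite /polyop_seq size_poly1 big_ord1 coef1 mul1r.
  by move=> n _; rewrite /polyop_seq size_poly0 big_ord0 cabs0 expr0n mulr0.
set f := (shapiro_pair d k).1 in IH *; set g := (shapiro_pair d k).2 in IH *.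
set s := lacunary_step k.
pose u := polyop_seq f (wshift w) z.
pose v := iter s (wshift w) (polyop_seq g (wshift w) z).
have vu : shields_norm L v <= shields_norm L (polyop_seq g (wshift w) z).
  exact: shields_norm_iter.
apply: (@le_trans _ _ ((1 + d ^+ 2) * (shields_norm L u + shields_norm L v))); last first.
  by rewrite (exprS _ k) -mulrA ler_wpM2l // (le_trans _ IH) // lerD2l.
rewrite /shields_norm -!big_split /= mulr_sumr le_eqVlt; apply/orP; left; apply/eqP.
apply: eq_bigr => n _ /=.
rewrite -!mulrDr mulrCA -sqr_cabs_parallelogram -scaleNr !polyop_seqDZ mulNr.
by rewrite !polyop_seqXn.
Qed.

Lemma opnorm_shapiro_le d k : k%:R * d ^+ 2 <= 2^-1 ->
  (opnorm_l2 (polyop_seq (shapiro_pair d k).1 (wshift w)) <= (2 * Num.max M 1)%:E)%E.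
Proof.
move=> kd; set C := Num.max M 1.
have C0 : 0 <= C by rewrite /C le_max ler01 orbT.
have pow_le2 : (1 + d ^+ 2) ^+ k <= 2.
  have := bernoulli_bound k (sqr_ge0 d).
  have : 0 <= (1 + d ^+ 2) ^+ k by rewrite exprn_ge0 ?addr_ge0 ?sqr_ge0.
  by move: ((1 + d ^+ 2) ^+ k) => y; nra.
apply: ge_ereal_sup => _ [z /= z1 <-]; apply/l2norm_le => [|L]; first by rewrite mulr_ge0.
have {}z1 := (l2norm_le z ler01).1 z1 L.
set y := polyop_seq _ _ z.
have y_le : \sum_(k < L) cabs (y k) ^+ 2 <= shields_norm L y.
  apply: ler_sum => n _; rewrite ler_peMl ?sqr_ge0 //.
  by rewrite exprn_ege1 // shields_weight_ge1.
have z_le : shields_norm L z <= C ^+ 2 * 1.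
  rewrite expr1n in z1; apply: (@le_trans _ _ (C ^+ 2 * \sum_(k < L) cabs (z k) ^+ 2)).
    rewrite mulr_sumr; apply: ler_sum => n _; rewrite ler_wpM2r ?sqr_ge0 //.
    rewrite lerXn2r ?nnegrE ?shields_weight_le //.
    by rewrite (le_trans ler01) ?shields_weight_ge1.
  by rewrite ler_wpM2l ?sqr_ge0.
have sn_ge0 z' : 0 <= shields_norm L z'.
  by apply: sumr_ge0 => n _; rewrite mulr_ge0 ?sqr_ge0.
have := shields_norm_shapiro d L k z; rewrite -/y => h.
have := sn_ge0 (polyop_seq (shapiro_pair d k).2 (wshift w) z).
have := sn_ge0 z; have := sqr_ge0 C.
have : (1 + d ^+ 2) ^+ k * shields_norm L z <= 2 * shields_norm L z.
  by rewrite ler_wpM2r.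
by rewrite exprMn; lra.
Qed.

End WeightedShift.

(** * Foguel-Hankel operators on spaces of matrices *)

Section HilbertTriangle.
Variables (R : realType) (H : hilbertSpace R).
Implicit Types x y : H.

Lemma hnorm_ge0 x : 0 <= hnorm x. Proof. exact: sqrtr_ge0. Qed.

Lemma hinnerDl x y z : hinner (x + y : H) z = hinner x z + hinner y z.
Proof. exact: (formDl (@hinner_linear R H)). Qed.

Lemma hinnerDr x y z : hinner z (x + y : H) = hinner z x + hinner z y.
Proof. by rewrite hinner_conj hinnerDl rmorphD /= -!hinner_conj. Qed.

Lemma hsqDZ x y (c d : R) :
  hsq ((c%:C)%C *: x + (d%:C)%C *: y) =
  c ^+ 2 * hsq x + 2 * (c * d) * complex.Re (hinner x y) + d ^+ 2 * hsq y.
Proof.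
rewrite /hsq !hinnerDl !hinnerDr !hinnerZl !hinnerZr (hinner_conj y x).
have := hinner_hsq x; have := hinner_hsq y; rewrite /hsq => -> ->.
case: (hinner y x) => a b; rewrite /=; ring.
Qed.

Lemma Re_hinner_le x y : complex.Re (hinner x y) <= hnorm x * hnorm y.
Proof.
have [x0|x_neq0] := eqVneq (hnorm x) 0.
  have -> : x = 0 by apply: hinner_eq0; rewrite hinner_hsq -hnorm_sqr x0 expr0n.
  by rewrite (form0l (@hinner_linear R H)) mulr_ge0 ?hnorm_ge0.
have [y0|y_neq0] := eqVneq (hnorm y) 0.
  have -> : y = 0 by apply: hinner_eq0; rewrite hinner_hsq -hnorm_sqr y0 expr0n.
  by rewrite hinner_conj (form0l (@hinner_linear R H)) conjc0 mulr_ge0 ?hnorm_ge0.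
have x_gt0 : 0 < hnorm x by rewrite lt0r x_neq0 hnorm_ge0.
have y_gt0 : 0 < hnorm y by rewrite lt0r y_neq0 hnorm_ge0.
(* Cauchy-Schwarz from the square of |y| x - |x| y, divided by 2 |x| |y|. *)
have := hsq_ge0 (((hnorm y)%:C)%C *: x + ((- hnorm x)%:C)%C *: y).
rewrite hsqDZ -!hnorm_sqr => h.
rewrite -subr_ge0 -(pmulr_rge0 _ (mulr_gt0 x_gt0 y_gt0)) -(pmulr_rge0 _ (ltr0n R 2)).
by apply: le_trans h _; rewrite le_eqVlt; apply/orP; left; apply/eqP; ring.
Qed.

Lemma ler_hnormD x y : hnorm (x + y) <= hnorm x + hnorm y.
Proof.
rewrite -(@ler_pXn2r _ 2) ?nnegrE ?addr_ge0 ?hnorm_ge0 //.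
have := hsqDZ x y 1 1; rewrite !scale1r hnorm_sqr => ->.
by rewrite -!hnorm_sqr; have := Re_hinner_le x y; nra.
Qed.

Lemma hnormZ c x : hnorm (c *: x) = cabs c * hnorm x.
Proof.
by rewrite /hnorm -/(hsq _) hsqZ sqrtrM ?sqr_ge0 // sqrtr_sqr ger0_norm ?cabs_ge0.
Qed.

Lemma hnorm0 : hnorm (0 : H) = 0.
Proof. by rewrite -(scale0r (0 : H)) hnormZ cabs0 mul0r. Qed.

Lemma ler_hnorm_sum n (v : 'I_n -> H) : hnorm (\sum_i v i) <= \sum_i hnorm (v i).
Proof.
elim/big_rec2: _ => [|i y x _ h]; first by rewrite hnorm0.
by apply: le_trans (ler_hnormD _ _) _; rewrite lerD2l.
Qed.

End HilbertTriangle.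

Lemma real_cauchy_cvg (R : realType) (u : nat -> R) :
    (forall e : R, 0 < e -> exists N, forall m n, (N <= m)%N -> (N <= n)%N ->
      `|u m - u n| < e) ->
  exists l, forall e : R, 0 < e -> exists N, forall n, (N <= n)%N -> `|u n - l| < e.
Proof.
move=> u_cauchy.
(* The limit is found as a lower limit: the supremum of the eventual lower bounds. *)
pose E : set R := fun a => exists N, forall n, (N <= n)%N -> a <= u n.
have E_le (e : R) N (a : R) : (forall n, (N <= n)%N -> `|u n - u N| < e) -> E a ->
  a <= u N + e.
  move=> uN [N' aN'].
  have h1 := aN' _ (leq_maxr N N'); have := uN _ (leq_maxl N N').
  by rewrite ltr_norml => /andP[_]; lra.
have E_ge (e : R) N : (forall n, (N <= n)%N -> `|u n - u N| < e) -> E (u N - e).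
  by move=> uN; exists N => n /uN; rewrite ltr_norml => /andP[]; lra.
have E_sup : has_sup E.
  have [N uN] := u_cauchy 1 ltr01.
  have uN' n : (N <= n)%N -> `|u n - u N| < 1 by move=> Nn; apply: uN.
  by split; [exists (u N - 1); apply: E_ge|exists (u N + 1) => a; apply: E_le].
exists (sup E) => e e0; have e3 : 0 < e / 3 by rewrite divr_gt0.
have [N uN] := u_cauchy _ e3.
have uN' n : (N <= n)%N -> `|u n - u N| < e / 3 by move=> Nn; apply: uN.
have lo : u N - e / 3 <= sup E by apply: ub_le_sup; [case: E_sup|apply: E_ge].
have hi : sup E <= u N + e / 3 by apply: ge_sup => [|a]; [case: E_sup|apply: E_le].
exists N => n /uN'; rewrite !ltr_norml => /andP[h1 h2].
by apply/andP; split; lra.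
Qed.

(** * Complex matrices with the Hilbert-Schmidt inner product *)

Section MatrixHilbert.
Variables (R : realType) (m n : nat).
Local Notation V := 'M[R[i]]_(m, n).
Implicit Types x y z : V.

Definition mx_inner x y : R[i] := \sum_i \sum_j x i j * conjc (y i j).

Definition mx_sq x : R := \sum_i \sum_j cabs (x i j) ^+ 2.

Lemma mx_inner_linear a x y z :
  mx_inner (a *: x + y) z = a * mx_inner x z + mx_inner y z.
Proof.
rewrite /mx_inner mulr_sumr -big_split; apply: eq_bigr => i _ /=.
rewrite mulr_sumr -big_split; apply: eq_bigr => j _ /=.
by rewrite !mxE mulrDl mulrA.
Qed.

Lemma mx_inner_conj x y : mx_inner y x = conjc (mx_inner x y).
Proof.
rewrite /mx_inner rmorph_sum; apply: eq_bigr => i _ /=.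
rewrite rmorph_sum; apply: eq_bigr => j _ /=.
by rewrite rmorphM /= conjcK mulrC.
Qed.

Lemma mx_innerE x : mx_inner x x = real_complex R (mx_sq x).
Proof.
rewrite rmorph_sum; apply: eq_bigr => i _; rewrite rmorph_sum; apply: eq_bigr => j _.
by rewrite -sqr_normc sqr_normc_cabs.
Qed.

Lemma mx_sq_ge0 x : 0 <= mx_sq x.
Proof. by apply: sumr_ge0 => i _; apply: sumr_ge0 => j _; rewrite sqr_ge0. Qed.

Lemma mx_inner_ge0 x : 0 <= mx_inner x x.
Proof. by rewrite mx_innerE lecR mx_sq_ge0. Qed.

Lemma cabs_le_mx_sq x i j : cabs (x i j) ^+ 2 <= mx_sq x.
Proof.
rewrite /mx_sq (bigD1 i) //= (bigD1 j) //= -addrA lerDl addr_ge0 ?sumr_ge0 //.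
  by move=> k _; rewrite sqr_ge0.
by move=> k _; apply: sumr_ge0 => l _; rewrite sqr_ge0.
Qed.

Lemma mx_inner_eq0 x : mx_inner x x = 0 -> x = 0.
Proof.
rewrite mx_innerE => /complexI x0; apply/matrixP => i j; rewrite mxE; apply/eqP.
by rewrite -cabs_eq0 -sqrf_eq0 eq_le sqr_ge0 andbT -x0 cabs_le_mx_sq.
Qed.

Lemma mx_complete (u : nat -> V) :
    (forall e : R, 0 < e -> exists N : nat, forall p q : nat, (N <= p)%N -> (N <= q)%N ->
      Num.sqrt (complex.Re (mx_inner (u p - u q) (u p - u q))) < e) ->
  exists l : V, forall e : R, 0 < e -> exists N : nat, forall p : nat, (N <= p)%N ->
      Num.sqrt (complex.Re (mx_inner (u p - l) (u p - l))) < e.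
Proof.
have nE x : Num.sqrt (complex.Re (mx_inner x x)) = Num.sqrt (mx_sq x) by rewrite mx_innerE.
move=> u_cauchy.
have part_le (x : V) (i : 'I_m) (j : 'I_n) (e : R) : 0 < e -> Num.sqrt (mx_sq x) < e ->
    `|complex.Re (x i j)| < e /\ `|complex.Im (x i j)| < e.
  move=> e0; rewrite -(@ltr_pXn2r _ 2) ?nnegrE ?sqrtr_ge0 ?(ltW e0) //
    sqr_sqrtr ?mx_sq_ge0 // => h.
  have {h} := le_lt_trans (cabs_le_mx_sq x i j) h.
  rewrite /cabs sqr_sqrtr ?addr_ge0 ?sqr_ge0 // => h.
  by split; rewrite -(@ltr_pXn2r _ 2) ?nnegrE ?(ltW e0) // real_normK ?num_real //;
    apply: le_lt_trans h; rewrite ?lerDl ?lerDr sqr_ge0.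
have cvg_part (f : R[i] -> R) (fB : forall a b, f (a - b) = f a - f b)
    (f_le : forall (x : V) i j (e : R), 0 < e -> Num.sqrt (mx_sq x) < e ->
      `|f (x i j)| < e) i j :
    {l : R | forall e : R, 0 < e -> exists N, forall p, (N <= p)%N -> `|f (u p i j) - l| < e}.
  apply/cid/real_cauchy_cvg => e e0; have [N uN] := u_cauchy e e0.
  exists N => p q Np Nq; rewrite -fB; have := f_le (u p - u q) i j e e0.
  by rewrite !mxE; apply; rewrite -nE uN.
have re := cvg_part (@complex.Re R) _ (fun x i j e e0 h => (part_le x i j e e0 h).1).
have im := cvg_part (@complex.Im R) _ (fun x i j e e0 h => (part_le x i j e e0 h).2).
have {}re := re (fun a b => raddfB _ a b).
have {}im := im (fun a b => raddfB _ a b).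
exists (\matrix_(i, j) Complex (sval (re i j)) (sval (im i j))) => e e0.
(* With e = c (2mn + 1), an error below c in every real and imaginary part gives a squared norm of
   at most 2mn c^2 < e^2. The added 1 covers empty matrices. *)
have d0 : 0 < 2 * (m * n)%:R + 1 :> R by rewrite ltr_wpDl // mulr_ge0.
have [c c0 eE] : exists2 c : R, 0 < c & e = c * (2 * (m * n)%:R + 1).
  by exists (e / (2 * (m * n)%:R + 1)); rewrite ?divr_gt0 // divfK // lt0r_neq0.
have /choice[F FP] (ij : 'I_m * 'I_n) : exists N : nat, forall p, (N <= p)%N ->
    `|complex.Re (u p ij.1 ij.2) - sval (re ij.1 ij.2)| < c /\
    `|complex.Im (u p ij.1 ij.2) - sval (im ij.1 ij.2)| < c.
  have [N1 h1] := svalP (re ij.1 ij.2) c c0; have [N2 h2] := svalP (im ij.1 ij.2) c c0.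
  exists (maxn N1 N2) => p; rewrite geq_max => /andP[p1 p2].
  by split; [apply: h1|apply: h2].
exists (\max_ij F ij) => p Np; rewrite nE.
rewrite -(@ltr_pXn2r _ 2) ?nnegrE ?sqrtr_ge0 ?(ltW e0) // sqr_sqrtr ?mx_sq_ge0 //.
apply: (@le_lt_trans _ _ (\sum_(i < m) \sum_(j < n) 2 * c ^+ 2)).
  apply: ler_sum => i _; apply: ler_sum => j _.
  have Fp : (F (i, j) <= p)%N by apply: leq_trans Np; apply: leq_bigmax.
  have [/ltW h1 /ltW h2] := FP (i, j) p Fp; rewrite !mxE.
  rewrite -(@ler_pXn2r _ 2) ?nnegrE ?(ltW c0) // real_normK ?num_real // in h1.
  rewrite -(@ler_pXn2r _ 2) ?nnegrE ?(ltW c0) // real_normK ?num_real // in h2.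
  rewrite /cabs sqr_sqrtr ?addr_ge0 ?sqr_ge0 //.
  by move: h1 h2; case: (u p i j) => a b /=; lra.
rewrite !sumr_const !card_ord -mulrnA -(mulr_natr (2 * c ^+ 2)) (mulnC n) eE exprMn.
have : 0 <= (m * n)%:R :> R by rewrite ler0n.
move: ((m * n)%:R : R) (c ^+ 2) (exprn_gt0 2 c0) => D c2 c2_gt0 D_ge0.
have D1 : 0 < (2 * D + 1) ^+ 2 - 2 * D by nra.
by have := mulr_gt0 c2_gt0 D1; lra.
Qed.

Definition mx_hilbert : hilbertSpace R :=
  HilbertSpace mx_inner_linear mx_inner_conj mx_inner_ge0 mx_inner_eq0 mx_complete.

Lemma hsq_mx (x : mx_hilbert) : hsq x = mx_sq x.
Proof. by rewrite /hsq [hinner x x]mx_innerE. Qed.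

End MatrixHilbert.

(** * Truncated Foguel-Hankel operators and their powers *)

Section FoguelHankel.
Variables (R : realType) (Q : nat).
Local Open Scope complex_scope.
Local Notation Hil := (mx_hilbert R 2 Q.+1).
Local Notation P := (delta_mx 1 0 : 'M[R[i]]_2).
Implicit Types (x : 'M[R[i]]_(2, Q.+1)) (eps : R).

Definition jordan : 'M[R[i]]_Q.+1 := \matrix_(a, b) (b == a.+1 :> nat)%:R.

Lemma jordan_exp s a b : (jordan ^+ s) a b = (b == a + s :> nat)%N%:R.
Proof.
elim: s b => [|s IH] b; first by rewrite expr0 addn0 mxE eq_sym.
rewrite exprSr mxE addnS.
case: b => -[|b] bQ.
  by rewrite big1 // => c _; rewrite [jordan _ _]mxE mulr0.
rewrite (bigD1 (Ordinal (ltnW bQ))) //= big1 ?addr0 => [|c cb].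
  by rewrite IH mxE /= eqxx mulr1 eqSS.
rewrite [jordan _ _]mxE /= eqSS; case: eqP => [bc|_]; last by rewrite mulr0.
by case/eqP: cb; apply: val_inj.
Qed.

Lemma jordan_exp_eq0 s : (Q < s)%N -> jordan ^+ s = 0.
Proof.
move=> Qs; apply/matrixP => a b; rewrite jordan_exp mxE ltn_eqF //.
by have := ltn_ord b; lia.
Qed.

Lemma hnorm_mul_jordan s x : hnorm (x *m jordan ^+ s : Hil) <= hnorm (x : Hil).
Proof.
elim: s => [|s]; first by rewrite expr0 mulmx1.
apply: le_trans; rewrite exprSr mulmxA; set y := x *m _.
rewrite -(@ler_pXn2r _ 2) ?nnegrE ?hnorm_ge0 // !hnorm_sqr !hsq_mx /mx_sq.
apply: ler_sum => i _; rewrite big_ord_recl [X in X + _](_ : _ = 0) ?add0r; last first.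
  by rewrite mxE big1 ?cabs0 ?expr0n // => c _; rewrite [jordan _ _]mxE mulr0.
rewrite [X in _ <= X]big_ord_recr /= -[X in X <= _]addr0 lerD ?sqr_ge0 //.
apply: ler_sum => j _; rewrite mxE (bigD1 (widen_ord (leqnSn Q) j)) //= big1 => [|c cj].
  by rewrite [jordan _ _]mxE /= eqxx mulr1 addr0.
rewrite [jordan _ _]mxE /=; case: eqP => [[jc]|_]; last by rewrite mulr0.
by case/eqP: cj; apply: val_inj.
Qed.

Lemma hnorm_delta_mul x : hnorm (P *m x : Hil) <= hnorm (x : Hil).
Proof.
rewrite -(@ler_pXn2r _ 2) ?nnegrE ?hnorm_ge0 // !hnorm_sqr !hsq_mx /mx_sq.
have PxE i j : (P *m x) i j = (i == 1)%:R * x 0 j.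
  rewrite mxE (bigD1 0) //= big1 ?addr0 => [|k k0]; first by rewrite mxE eqxx andbT.
  by rewrite mxE (negbTE k0) andbF mul0r.
rewrite (bigD1 0) //= [X in X + _]big1 ?add0r => [|j _]; last first.
  by rewrite PxE mul0r cabs0 expr0n.
rewrite (bigD1 1) //= [X in _ + X]big1 ?addr0 => [|i]; last first.
  by case: i => -[|[|]].
rewrite [X in _ <= X](bigD1 0) //= -[X in X <= _]addr0 lerD //.
  by apply: ler_sum => j _; rewrite PxE eqxx mul1r.
by apply: sumr_ge0 => i _; apply: sumr_ge0 => j _; rewrite sqr_ge0.
Qed.

Variable n : nat.
Hypothesis nQ : (2 ^ n <= Q)%N.

(* Up to flipping the coordinates, the Hankel matrix with entries 2^-k on the
   antidiagonals i + j + 1 = 2^k. *)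
Definition lacunary_mx : 'M[R[i]]_Q.+1 :=
  \sum_(k < n) ((2 ^ k)%:R^-1)%:C *: jordan ^+ (Q.+1 - 2 ^ k).

(** The two rows of x are the two summands of the space: right multiplication acts inside each row,
    and [P] moves row 0 to row 1. It is thus a block triangular operator with [jordan] twice on the
    diagonal. *)
Definition foguel_hankel eps (x : Hil) : Hil :=
  x *m jordan + eps%:C *: (P *m x *m lacunary_mx).

Lemma foguel_hankel_linear eps a (x y : Hil) :
  foguel_hankel eps (a *: x + y) = a *: foguel_hankel eps x + foguel_hankel eps y.
Proof.
rewrite /foguel_hankel mulmxDl -scalemxAl mulmxDr -scalemxAr mulmxDl -scalemxAl.
by rewrite !scalerDr !scalerA (mulrC a) addrACA.
Qed.

Lemma lacunary_mx_comm : lacunary_mx * jordan = jordan * lacunary_mx.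
Proof.
rewrite mulr_suml mulr_sumr; apply: eq_bigr => k _.
by rewrite -scalerAl -scalerAr -exprS -exprSr.
Qed.

Lemma delta_mul_delta : P *m P = 0.
Proof. by rewrite mul_delta_mx_0. Qed.

(** Since P^2 = 0 and [lacunary_mx] commutes with [jordan], the off-diagonal block obeys the Leibniz
    rule and becomes a derivative of the i-th power. At i = 0 the factor i kills the junk exponent
    [i.-1]. *)
Lemma iter_foguel_hankel eps i x : iter i (foguel_hankel eps) x =
  x *m jordan ^+ i + eps%:C *: (P *m (x *m (i%:R *: (jordan ^+ i.-1 * lacunary_mx)))).
Proof.
elim: i => [|i IH]; first by rewrite /= scale0r !mulmx0 scaler0 addr0 expr0 mulmx1.
rewrite iterS IH /foguel_hankel mulmxDl -addrA exprSr [x *m (_ * _)]mulmxA; congr (_ + _).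
have PP z : P *m (P *m z) = 0 :> 'M_(2, Q.+1) by rewrite mulmxA delta_mul_delta mul0mx.
set D := i%:R *: _; rewrite mulmxDr -(scalemxAr eps%:C) PP scaler0 addr0 -scalemxAl -scalerDr; congr (_ *: _)
  .
rewrite -!mulmxA -!mulmxDr; congr (_ *m (_ *m _)).
rewrite /D !mulmxE -scalerAl.
case: i {IH} @D => [|i] D; first by rewrite scale0r add0r scale1r.
rewrite /= -mulrA lacunary_mx_comm mulrA -exprSr.
by rewrite -[X in _ + X]scale1r -scalerDl natr1.
Qed.

(** A geometric tail starting at the first 2^k >= i. The subtracted term, exact under doubling,
    carries the induction. *)
Lemma lacunary_sum_le (i m : nat) :
  \sum_(k < m) (if (i <= 2 ^ k)%N then i%:R / (2 ^ k)%:R else 0) <=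
  (if (i <= 2 ^ m)%N then 2 - 2 * (i%:R / (2 ^ m)%:R) else 0 : R).
Proof.
elim: m => [|m IH].
  rewrite big_ord0 divr1; case: ifP => // i1.
  by rewrite subr_ge0 ler_piMr // lern1.
rewrite big_ord_recr /=.
have p0 : 0 < (2 ^ m)%:R :> R by rewrite ltr0n expn_gt0.
have e2 : (i%:R / (2 ^ m.+1)%:R : R) = i%:R / (2 ^ m)%:R / 2.
  by rewrite expnS natrM; field; rewrite lt0r_neq0.
have [im|im] := boolP (i <= 2 ^ m)%N.
  rewrite im in IH; rewrite (_ : (i <= 2 ^ m.+1)%N); last by rewrite expnS; lia.
  by rewrite e2; lra.
rewrite (negbTE im) in IH; rewrite addr0; apply: le_trans IH _; case: ifP => // im1.
rewrite subr_ge0 ler_piMr // ler_pdivrMr ?mul1r ?ler_nat //.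
Qed.

(** The k-th summand has coefficient i/2^k and vanishes by nilpotency when 2^k < i; the surviving
    coefficients sum to at most 2, whatever i and n are. *)
Lemma hnorm_mul_deriv_le i x :
  hnorm (x *m (i%:R *: (jordan ^+ i.-1 * lacunary_mx)) : Hil) <= 2 * hnorm (x : Hil).
Proof.
case: i => [|i]; first by rewrite scale0r mulmx0 [hnorm _]hnorm0 mulr_ge0 ?hnorm_ge0.
pose c k : R := if (i < 2 ^ k)%N then i.+1%:R / (2 ^ k)%:R else 0.
have -> : x *m (i.+1%:R *: (jordan ^+ i.+1.-1 * lacunary_mx)) =
    \sum_(k < n) (c k)%:C *: (x *m jordan ^+ (i + (Q.+1 - 2 ^ k))).
  rewrite /lacunary_mx mulr_sumr scaler_sumr mulmx_sumr; apply: eq_bigr => k _ /=.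
  rewrite -scalerAr scalerA -exprD -scalemxAr /c; case: ltnP => ik.
    by congr (_ *: _); rewrite rmorphM rmorph_nat.
  rewrite jordan_exp_eq0 ?mulmx0 ?scaler0 //.
  have : (2 ^ k <= 2 ^ n)%N by rewrite leq_exp2l // ltnW.
  by lia.
apply: le_trans (ler_hnorm_sum (H := Hil) _) _.
have c_ge0 k : 0 <= c k by rewrite /c; case: ifP => // _; rewrite divr_ge0.
apply: (@le_trans _ _ (\sum_(k < n) c k * hnorm (x : Hil))).
  apply: ler_sum => k _; rewrite [X in X <= _](@hnormZ _ Hil).
  by rewrite cabs_real ger0_norm // ler_wpM2l // hnorm_mul_jordan.
rewrite -mulr_suml ler_wpM2r ?hnorm_ge0 //.
apply: le_trans (lacunary_sum_le i.+1 n) _.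
by case: ifP => // _; rewrite gerBl mulr_ge0 // divr_ge0.
Qed.

Lemma hnorm_iter_foguel_hankel eps i (x : Hil) : 0 <= eps ->
  hnorm (iter i (foguel_hankel eps) x) <= (1 + 2 * eps) * hnorm x.
Proof.
move=> eps0; rewrite iter_foguel_hankel; apply: le_trans (ler_hnormD (H := Hil) _ _) _.
rewrite mulrDl mul1r lerD ?hnorm_mul_jordan // [X in X <= _](@hnormZ _ Hil).
rewrite cabs_real ger0_norm // (mulrC 2) -mulrA ler_wpM2l //.
by apply: le_trans (hnorm_delta_mul _) (hnorm_mul_deriv_le _ _).
Qed.

(** The top corner of a power of [jordan] is nonzero only for exponent Q. In the i-th power of the
    operator this selects i = 2^k, where the factor i cancels the coefficient 2^-k. *)
Lemma polyop_foguel_hankel_corner eps (f : {poly R[i]}) :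
  polyop f (foguel_hankel eps) (delta_mx 0 0 : Hil) 1 ord_max =
  eps%:C * \sum_(k < n) f`_(2 ^ k).
Proof.
have h i : iter i (foguel_hankel eps) (delta_mx 0 0) 1 ord_max =
    eps%:C * \sum_(k < n) (i == 2 ^ k)%N%:R.
  rewrite iter_foguel_hankel mxE [X in X + _](_ : _ = 0) ?add0r; last first.
    by rewrite mxE big1 // => j _; rewrite mxE mul0r.
  rewrite mulmxA mul_delta_mx mxE; congr (_ * _).
  rewrite mxE (bigD1 0) //= big1 ?addr0 => [|j j0]; last first.
    by rewrite mxE (negbTE j0) andbF mul0r.
  rewrite mxE eqxx mul1r.
  case: i => [|i]; first by rewrite scale0r mxE big1 // => k _; rewrite eq_sym expn_eq0.
  rewrite /lacunary_mx mulr_sumr scaler_sumr summxE; apply: eq_bigr => k _.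
  rewrite -scalerAr -exprD scalerA mxE jordan_exp /=.
  have k2 : (2 ^ k <= 2 ^ n)%N by rewrite leq_exp2l // ltnW.
  rewrite (_ : (Q == 0 + (i.+1.-1 + (Q.+1 - 2 ^ k)))%N = (i.+1 == 2 ^ k)%N); last first.
    by apply/eqP/eqP => /=; lia.
  case: eqP => [->|_]; last by rewrite mulr0.
  by rewrite mulr1 -(rmorph_nat (real_complex R)) -rmorphM mulfV ?rmorph1 //
    pnatr_eq0 expn_eq0.
rewrite /polyop summxE.
under eq_bigr do rewrite mxE h mulrCA mulr_sumr.
rewrite -mulr_sumr exchange_big; congr (_ * _); apply: eq_bigr => k _ /=.
have [kf|kf] := ltnP (2 ^ k) (size f).
  rewrite (bigD1 (Ordinal kf)) //= eqxx mulr1 big1 ?addr0 // => j jk.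
  by case: eqP => [jE|_]; rewrite ?mulr0 //; case/eqP: jk; apply: val_inj.
rewrite nth_default // big1 // => j _.
by case: eqP => [jE|_]; rewrite ?mulr0 //; move: (ltn_ord j); rewrite jE ltnNge kf.
Qed.

Lemma opnorm_foguel_hankel_ge eps (f : {poly R[i]}) (C : R) :
    (opnorm (polyop f (foguel_hankel eps)) <= C%:E)%E ->
  cabs (eps%:C * \sum_(k < n) f`_(2 ^ k)) <= C.
Proof.
move=> fC; rewrite -polyop_foguel_hankel_corner; set x : Hil := delta_mx 0 0.
rewrite -lee_fin; apply: le_trans fC.
apply: (@le_trans _ _ (hnorm (polyop f (foguel_hankel eps) x))%:E); last first.
  apply: ereal_sup_ubound; exists x => //=.
  rewrite -(@ler_pXn2r _ 2) ?nnegrE ?hnorm_ge0 // hnorm_sqr hsq_mx expr1n /mx_sq.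
  rewrite (bigD1 0) //= (bigD1 0) //= big1 => [|j j0]; last first.
    by rewrite mxE (negbTE j0) andbF cabs0 expr0n.
  rewrite big1 => [|i i0]; last by rewrite big1 // => j _;
    rewrite mxE (negbTE i0) cabs0 expr0n.
  by rewrite mxE !eqxx (_ : 1%:R = 1%:C) // cabs_real normr1 expr1n !addr0.
rewrite lee_fin -(@ler_pXn2r _ 2) ?nnegrE ?cabs_ge0 ?hnorm_ge0 //.
by rewrite hnorm_sqr hsq_mx cabs_le_mx_sq.
Qed.

End FoguelHankel.

Lemma no_dominating_shift (R : realType) (K : R) (w : nat -> R[i]) : 1 < K ->
    power_bounded_l2 (wshift w) ->
    (forall (H : hilbertSpace R) (A : H -> H),
       bounded_linear A ->
       (forall n : nat, (opnorm (iter n A) <= K%:E)%E) ->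
       forall f : {poly R[i]},
         (opnorm (polyop f A) <= opnorm_l2 (polyop_seq f (wshift w)))%E) ->
  False.
Proof.
move=> K_gt1 [M w_pb] dom.
pose eps := (K - 1) / 2; have eps_gt0 : 0 < eps by rewrite divr_gt0 // subr_gt0.
have epsK : 1 + 2 * eps = K by rewrite /eps; field.
have K0 : 0 <= K by rewrite ltW // (lt_trans ltr01).
pose C := 2 * Num.max M 1.
suff h m : eps * m.+1%:R <= C.
  have C0 : 0 <= C by rewrite mulr_ge0 // le_max ler01 orbT.
  have := archi_boundP (divr_ge0 C0 (ltW eps_gt0)); set m := Num.bound _ => hm.
  have := h m; rewrite leNgt => /negP; apply.
  rewrite mulrC -ltr_pdivrMr //; apply: lt_trans hm _.
  by rewrite ltr_nat.
(* These values give n d^2 = 1/2, so the norm on the shift stays bounded, while n d = m + 1 is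
   unbounded. *)
pose n := (2 * m.+1 ^ 2)%N; pose d : R := (2 * m.+1%:R)^-1.
have m0 : m.+1%:R != 0 :> R by rewrite pnatr_eq0.
pose A := @foguel_hankel R (2 ^ n) n eps.
have A_pb i x : hsq (iter i A x) <= K ^+ 2 * hsq x.
  rewrite -!hnorm_sqr -exprMn lerXn2r ?nnegrE ?mulr_ge0 ?hnorm_ge0 //.
  by rewrite -epsK hnorm_iter_foguel_hankel // ltW.
have A_lin : bounded_linear A.
  split; first exact: foguel_hankel_linear.
  exists K => x; rewrite -(@ler_pXn2r _ 2) ?nnegrE ?mulr_ge0 ?hnorm_ge0 //.
  by rewrite exprMn !hnorm_sqr; apply: (A_pb 1%N).
have A_op i : (opnorm (iter i A) <= K%:E)%E by apply: opnorm_le.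
have nd : n%:R * d ^+ 2 <= 2^-1.
  rewrite le_eqVlt; apply/orP; left; apply/eqP; rewrite /n /d natrM natrX.
  by move: (m.+1%:R : R) m0 => y y0; field.
have := le_trans (dom _ A A_lin A_op (shapiro_pair d n).1) (opnorm_shapiro_le w_pb nd).
move/opnorm_foguel_hankel_ge => /(_ (leqnn _)).
have [_ _ _ _ lac] := shapiro_pair_coef d n.
under eq_bigr do rewrite lac ltn_ord.
rewrite sumr_const card_ord -(rmorphMn (real_complex R)) -rmorphM cabs_real.
have -> : eps * (d *+ n) = eps * m.+1%:R.
  congr (_ * _); rewrite -[d *+ n]mulr_natr /n /d natrM natrX.
  by move: (m.+1%:R : R) m0 => y y0; field.
by rewrite ger0_norm // mulr_ge0 // ltW.
Qed.

Unset Implicit Arguments.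
Set Strict Implicit.
Set Printing Implicit Defensive.

Theorem theorem2p6 (R : realType) (K : R) (hK : 1 < K) :
  (* (1) *)
  (forall (H : hilbertSpace R) (T : H -> H),
      bounded_linear T ->
      (forall n : nat, (opnorm (iter n T) <= K%:E)%E) ->
      forall p : {poly R[i]},
        (opnorm (polyop p T) <= opnorm_l2 (polyop_seq p (S_K K)))%E) /\
  (* (2) *)
  ~ (exists w : nat -> R[i],
       bounded_weight w /\ power_bounded_l2 (wshift w) /\
       forall (H : hilbertSpace R) (A : H -> H),
         bounded_linear A ->
         (forall n : nat, (opnorm (iter n A) <= K%:E)%E) ->
         forall f : {poly R[i]},
           (opnorm (polyop f A) <= opnorm_l2 (polyop_seq f (wshift w)))%E).
Proof.
split=> [H T [T_lin _] T_pb p|[w [_ [w_pb dom]]]].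
  exact: S_K_dominates.
exact: no_dominating_shift hK w_pb dom.
Qed.
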